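(* Let $n,J\ge 1$ and let $X=[x_1^{*},\dots,x_J^{*}]^{*}\in\mathbb{C}^{Jn}$ with $x_j\in\mathbb{C}^n$. Then $$\|X\|_{\mathcal{CA}}=\inf\Big\{\tfrac{1}{2n}\Big(\operatorname{tr}\operatorname{Toep}(u_c)+\sum_{j=1}^{J}\operatorname{tr}\operatorname{Toep}(u_j)\Big)+\tfrac12 t\Big\},$$ where the infimum is over all $u_c,u_1,\dots,u_J\in\mathbb{C}^n$, $t\in\mathbb{R}$, and $z_c,z_1,\dots,z_J\in\mathbb{C}^n$ with $z_c+z_j=x_j$ for all $j\in\{1,\dots,J\}$, subject to the linear matrix inequality $$\begin{bmatrix}\operatorname{diag}\big(\operatorname{Toep}(u_c),\operatorname{Toep}(u_1),\dots,\operatorname{Toep}(u_J)\big) & Z\\ Z^{*} & t\end{bmatrix}\succeq 0,\qquad Z=[z_c^{*},z_1^{*},\dots,z_J^{*}]^{*}\in\mathbb{C}^{(J+1)n}.$$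
   Context: For $f\in[0,1]$ and $\phi\in[0,2\pi)$, the atom $a(f,\phi)\in\mathbb{C}^n$ has entries $[a(f,\phi)]_t=e^{i(2\pi f t+\phi)}$, $t=0,\dots,n-1$, and $a(f)=a(f,0)$. The atomic norm of $x\in\mathbb{C}^n$ is $\|x\|_{\mathcal{A}}=\inf\{\sum_k|c_k| : x=\sum_k |c_k|\,a(f_k,\phi_k),\ f_k\in[0,1],\ \phi_k\in[0,2\pi)\}$ (finite sums). The concatenated atomic norm (CA-norm) of $X=[x_1^*,\dots,x_J^*]^*$ is $\|X\|_{\mathcal{CA}}=\inf\{\|z_c\|_{\mathcal{A}}+\sum_{j=1}^J\|z_j\|_{\mathcal{A}} : z_c,z_j\in\mathbb{C}^n,\ z_c+z_j=x_j\ \forall j\}$. For $u\in\mathbb{C}^n$, $\operatorname{Toep}(u)$ denotes the $n\times n$ Hermitian Toeplitz matrix whose first column is $u$. $\operatorname{diag}(\cdot)$ denotes the block-diagonal matrix, $^{*}$ the conjugate transpose, and $\succeq 0$ positive semidefiniteness. *)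

(* Defs.v *)
From Stdlib Require Import Reals Lra Lia List Classical ClassicalEpsilon.
Open Scope R_scope.

Definition Cx : Type := (R * R)%type.
Definition Cre (z : Cx) : R := fst z.
Definition Cim (z : Cx) : R := snd z.
Definition Cadd (a b : Cx) : Cx := (fst a + fst b, snd a + snd b).
Definition Cmul (a b : Cx) : Cx :=
  (fst a * fst b - snd a * snd b, fst a * snd b + snd a * fst b).
Definition Cconj (a : Cx) : Cx := (fst a, - snd a).
Definition Cmod (a : Cx) : R := sqrt (fst a ^ 2 + snd a ^ 2).
Definition RtoC (r : R) : Cx := (r, 0).
Definition C0 : Cx := (0, 0).
Definition Cexpi (theta : R) : Cx := (cos theta, sin theta).

Fixpoint Csum (N : nat) (f : nat -> Cx) : Cx :=
  match N with O => C0 | S m => Cadd (Csum m f) (f m) end.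
Fixpoint Rsum (N : nat) (f : nat -> R) : R :=
  match N with O => 0 | S m => Rsum m f + f m end.

Definition is_lower_bound (E : R -> Prop) (m : R) : Prop := forall x, E x -> m <= x.
Definition is_glb (E : R -> Prop) (m : R) : Prop :=
  is_lower_bound E m /\ (forall b, is_lower_bound E b -> b <= m).
(* the infimum of E when it exists (default 0 otherwise) *)
Definition Rinf (E : R -> Prop) : R :=
  match excluded_middle_informative (exists m, is_glb E m) with
  | left H => proj1_sig (constructive_indefinite_description _ H)
  | right _ => 0
  end.

(* vectors in Cx^n are functions nat -> Cx, only indices 0..n-1 matter *)
Definition atom (f phi : R) (t : nat) : Cx := Cexpi (2 * PI * f * INR t + phi).

Definition atom_comb (l : list (Cx * R * R)) (t : nat) : Cx :=
  fold_right (fun '(c, f, phi) acc => Cadd (Cmul (RtoC (Cmod c)) (atom f phi t)) acc) C0 l.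
Definition atom_cost (l : list (Cx * R * R)) : R :=
  fold_right (fun '(c, _, _) acc => Cmod c + acc) 0 l.
Definition valid_atoms (l : list (Cx * R * R)) : Prop :=
  Forall (fun '(_, f, phi) => 0 <= f <= 1 /\ 0 <= phi < 2 * PI) l.

Definition atomic_norm_set (n : nat) (x : nat -> Cx) (r : R) : Prop :=
  exists l, valid_atoms l /\ (forall t, (t < n)%nat -> x t = atom_comb l t)
            /\ r = atom_cost l.
Definition atomic_norm (n : nat) (x : nat -> Cx) : R := Rinf (atomic_norm_set n x).

(* ---------- concatenated atomic norm ----------
   x j (j = 0..J-1) is the block x_{j+1} of X. *)
Definition CA_set (n J : nat) (x : nat -> nat -> Cx) (r : R) : Prop :=
  exists (zc : nat -> Cx) (z : nat -> nat -> Cx),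
    (forall j s, (j < J)%nat -> (s < n)%nat -> Cadd (zc s) (z j s) = x j s) /\
    r = atomic_norm n zc + Rsum J (fun j => atomic_norm n (z j)).
Definition CA_norm (n J : nat) (x : nat -> nat -> Cx) : R := Rinf (CA_set n J x).

Definition Toep (u : nat -> Cx) (i j : nat) : Cx :=
  if Nat.leb j i then u (i - j)%nat else Cconj (u (j - i)%nat).
Definition trace (n : nat) (M : nat -> nat -> Cx) : Cx := Csum n (fun i => M i i).

Definition quad (N : nat) (M : nat -> nat -> Cx) (v : nat -> Cx) : Cx :=
  Csum N (fun i => Csum N (fun j => Cmul (Cconj (v i)) (Cmul (M i j) (v j)))).
Definition psd (N : nat) (M : nat -> nat -> Cx) : Prop :=
  forall v : nat -> Cx, Cim (quad N M v) = 0 /\ 0 <= Cre (quad N M v).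

(* The (J+1)n+1 square matrix
   [ diag(Toep(T 0),...,Toep(T J))   Zv ; Zv^*   t ]
   with T 0 = u_c, T (j+1) = u_{j+1}; Zv = [z_c; z_1; ...; z_J] (block b of Zv is Zb b). *)
Definition lmi_matrix (n J : nat) (T : nat -> nat -> Cx) (Zb : nat -> nat -> Cx) (t : R)
  (i j : nat) : Cx :=
  let N0 := ((J + 1) * n)%nat in
  if Nat.ltb i N0 then
    if Nat.ltb j N0 then
      (if Nat.eqb (i / n) (j / n) then Toep (T (i / n)%nat) (i mod n) (j mod n) else C0)
    else Zb (i / n)%nat (i mod n)
  else
    if Nat.ltb j N0 then Cconj (Zb (j / n)%nat (j mod n))
    else RtoC t.

(* feasible objective values of the SDP; u j, z j (j < J) stand for u_{j+1}, z_{j+1} *)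
Definition SDP_set (n J : nat) (x : nat -> nat -> Cx) (r : R) : Prop :=
  exists (uc : nat -> Cx) (u : nat -> nat -> Cx) (t : R) (zc : nat -> Cx) (z : nat -> nat -> Cx),
    (forall j s, (j < J)%nat -> (s < n)%nat -> Cadd (zc s) (z j s) = x j s) /\
    psd ((J + 1) * n + 1)
        (lmi_matrix n J (fun b => match b with O => uc | S b' => u b' end)
                        (fun b => match b with O => zc | S b' => z b' end) t) /\
    r = / (2 * INR n) * (Cre (trace n (Toep uc))
                         + Rsum J (fun j => Cre (trace n (Toep (u j)))))
        + / 2 * t.

(* Main.v *)
(* Both inequalities compare a finite atomic decomposition with the block LMI.  Atoms give an LMI
   point because the block matrix is then the sum of the rank one matrices |c| (a;1)(a;1)^*.
   Conversely, for a feasible point each T_b = Toep(u_b) is positive semidefinite; after adding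
   eps I one solves (T_b + eps I) y_b = z_b, and the test vector (y_c, y_1, ..., y_J, -1) gives
   sum_b <y_b, z_b> <= t.  A positive definite Toeplitz matrix is a sum of matrices
   w_m a(f_m) a(f_m)^* with w_m >= 0, so z_b = sum_m w_m <a(f_m), y_b> a(f_m), and AM-GM bounds
   the atomic norm of z_b by (u_b(0) + eps + <y_b, z_b>) / 2.

   The Vandermonde decomposition is obtained without polynomial roots: a positive definite
   Toeplitz matrix extends to positive definite Toeplitz matrices of any size N, whose Fejer means
   on the grid m/(2N) are nonnegative weights with moments (1 - k/N) u_k; the factor 1 - k/N is
   absorbed beforehand by a small perturbation of u. *)

Require Import Defs.
From Stdlib Require Import Reals Lra Lia List Classical ClassicalEpsilon.
Open Scope R_scope.

(** * Complex arithmetic and finite sums *)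

Definition Copp (a : Cx) : Cx := (- fst a, - snd a).
Definition Csub (a b : Cx) : Cx := Cadd a (Copp b).
Definition Cone : Cx := RtoC 1.

Declare Scope cx_scope.
Delimit Scope cx_scope with Cx.
Infix "+" := Cadd : cx_scope.
Infix "*" := Cmul : cx_scope.
Infix "-" := Csub : cx_scope.
Notation "- a" := (Copp a) : cx_scope.

Ltac cx_unfold :=
  unfold Csub, Cadd, Cmul, Copp, Cconj, Cre, Cim, RtoC, Cone, C0 in *; simpl in *.
Ltac cx_ring := cx_unfold; apply injective_projections; simpl; ring.

Lemma Cx_ring_theory : ring_theory C0 Cone Cadd Cmul Csub Copp (@eq Cx).
Proof. constructor; intros; try reflexivity; cx_ring. Qed.
Add Ring Cx_ring : Cx_ring_theory.

Lemma Cconj_add (a b : Cx) : Cconj (a + b)%Cx = (Cconj a + Cconj b)%Cx.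
Proof. cx_ring. Qed.
Lemma Cconj_mul (a b : Cx) : Cconj (a * b)%Cx = (Cconj a * Cconj b)%Cx.
Proof. cx_ring. Qed.
Lemma Cconj_opp (a : Cx) : Cconj (- a)%Cx = (- Cconj a)%Cx.
Proof. cx_ring. Qed.
Lemma Cconj_conj (a : Cx) : Cconj (Cconj a) = a.
Proof. cx_ring. Qed.
Lemma Cconj_RtoC (r : R) : Cconj (RtoC r) = RtoC r.
Proof. cx_ring. Qed.
Lemma Cconj_C0 : Cconj C0 = C0.
Proof. cx_ring. Qed.
Lemma Cconj_Cone : Cconj Cone = Cone.
Proof. cx_ring. Qed.
Lemma RtoC_add (a b : R) : RtoC (a + b) = (RtoC a + RtoC b)%Cx.
Proof. cx_ring. Qed.
Lemma RtoC_mul (a b : R) : RtoC (a * b) = (RtoC a * RtoC b)%Cx.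
Proof. cx_ring. Qed.
Lemma Cre_add (a b : Cx) : Cre (a + b)%Cx = Cre a + Cre b.
Proof. reflexivity. Qed.
Lemma Cim_add (a b : Cx) : Cim (a + b)%Cx = Cim a + Cim b.
Proof. reflexivity. Qed.

Definition Cnorm2 (a : Cx) : R := Cre a ^ 2 + Cim a ^ 2.

Lemma Cnorm2_ge0 (a : Cx) : 0 <= Cnorm2 a.
Proof. unfold Cnorm2; nra. Qed.
Lemma Cconj_mul_self (a : Cx) : (Cconj a * a)%Cx = RtoC (Cnorm2 a).
Proof. unfold Cnorm2; cx_ring. Qed.
Lemma Cnorm2_gt0 (a : Cx) : a <> C0 -> 0 < Cnorm2 a.
Proof.
  intros H. destruct (Rle_lt_or_eq_dec _ _ (Cnorm2_ge0 a)) as [h|h]; [exact h|].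
  exfalso; apply H. destruct a as [p q]. unfold Cnorm2 in h; cx_unfold.
  assert (p = 0) by nra. assert (q = 0) by nra. now subst.
Qed.
Lemma Cx_eq_dec (a b : Cx) : {a = b} + {a <> b}.
Proof. apply excluded_middle_informative. Qed.

Lemma Cmul_inv_ex (a : Cx) : a <> C0 -> exists b, (a * b)%Cx = Cone.
Proof.
  intros H. exists (RtoC (/ Cnorm2 a) * Cconj a)%Cx.
  pose proof (Cnorm2_gt0 a H) as h.
  transitivity (RtoC (/ Cnorm2 a) * (Cconj a * a))%Cx; [ring|].
  rewrite Cconj_mul_self, <- RtoC_mul, Rinv_l by lra. reflexivity.
Qed.
Lemma Cmul_eq0 (a b : Cx) : (a * b)%Cx = C0 -> a <> C0 -> b = C0.
Proof.
  intros H Ha. destruct (Cmul_inv_ex a Ha) as [c Hc].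
  transitivity (c * (a * b))%Cx.
  - transitivity ((a * c) * b)%Cx; [rewrite Hc|]; ring.
  - rewrite H; ring.
Qed.

Lemma Cmod_ge0 (a : Cx) : 0 <= Cmod a.
Proof. apply sqrt_pos. Qed.
Lemma Cmod_sqr (a : Cx) : Cmod a ^ 2 = Cnorm2 a.
Proof. unfold Cmod. rewrite pow2_sqrt; [reflexivity|]. apply (Cnorm2_ge0 a). Qed.
Lemma Cmod_RtoC_mul (r : R) (a : Cx) : 0 <= r -> Cmod (RtoC r * a)%Cx = r * Cmod a.
Proof.
  intros Hr. unfold Cmod.
  replace (fst (RtoC r * a)%Cx ^ 2 + snd (RtoC r * a)%Cx ^ 2)
    with (r ^ 2 * (fst a ^ 2 + snd a ^ 2)) by (cx_unfold; ring).
  rewrite sqrt_mult by (try apply (Cnorm2_ge0 a); nra).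
  now rewrite sqrt_pow2.
Qed.
Lemma Cmod_RtoC (r : R) : 0 <= r -> Cmod (RtoC r) = r.
Proof.
  intros Hr. unfold Cmod; simpl. replace (r * (r * 1) + 0 * (0 * 1)) with (r ^ 2) by ring.
  now apply sqrt_pow2.
Qed.

(** * Complex exponentials and polar form *)

Lemma Cexpi_add (a b : R) : Cexpi (a + b) = (Cexpi a * Cexpi b)%Cx.
Proof.
  unfold Cexpi. rewrite cos_plus, sin_plus. apply injective_projections; simpl; ring.
Qed.
Lemma Cexpi_opp (a : R) : Cexpi (- a) = Cconj (Cexpi a).
Proof. unfold Cexpi, Cconj; simpl. now rewrite cos_neg, sin_neg. Qed.
Lemma Cexpi_0 : Cexpi 0 = Cone.
Proof. unfold Cexpi. now rewrite cos_0, sin_0. Qed.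

Lemma Cexpi_2PI_INR (k : nat) : Cexpi (2 * PI * INR k) = Cone.
Proof.
  replace (2 * PI * INR k) with (0 + 2 * INR k * PI) by ring.
  unfold Cexpi. rewrite cos_period, sin_period, cos_0, sin_0. reflexivity.
Qed.

(** By the half-angle formula cos a = 1 - 2 sin^2(a/2), and sin(a/2) > 0 on this range. *)
Lemma Cexpi_neq1 (a : R) : 0 < a < 2 * PI -> Cexpi a <> Cone.
Proof.
  intros [H1 H2] H. assert (Hc : cos a = 1) by exact (f_equal fst H).
  replace a with (2 * (a / 2)) in Hc by field. rewrite cos_2a_sin in Hc.
  pose proof (sin_gt_0 (a / 2) ltac:(lra) ltac:(lra)). nra.
Qed.

(** Supplies the phase of an atom. The arccosine of [p / m] lies in [0, PI] and is the right angle
    when the imaginary part is nonnegative; otherwise it is reflected to [2 * PI - acos (p / m)]. *)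
Lemma polar (z : Cx) :
  exists phi, 0 <= phi < 2 * PI /\ z = (RtoC (Cmod z) * Cexpi phi)%Cx.
Proof.
  pose proof PI_RGT_0 as Hpi.
  destruct (Cx_eq_dec z C0) as [->|Hz].
  { exists 0. split; [lra|]. change (Cmod C0) with (Cmod (RtoC 0)). rewrite Cmod_RtoC by lra. cx_ring. }
  pose proof (Cnorm2_gt0 z Hz) as Hn. pose proof (Cmod_sqr z) as Hm.
  pose proof (Cmod_ge0 z) as Hm0. destruct z as [p q]. unfold Cnorm2 in *; simpl in Hm, Hn.
  set (m := Cmod (p, q)) in *.
  assert (Hmp : 0 < m) by nra.
  assert (Hc2 : (p / m) ^ 2 + (q / m) ^ 2 = 1).
  { replace ((p / m) ^ 2 + (q / m) ^ 2) with ((p * (p * 1) + q * (q * 1)) / (m * (m * 1))) by (field; lra).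
    rewrite Hm. unfold Rdiv. apply Rinv_r. lra. }
  assert (Hc : -1 <= p / m <= 1) by nra.
  assert (Hsin : sin (acos (p / m)) = Rabs (q / m)).
  { rewrite sin_acos by lra. rewrite <- sqrt_Rsqr_abs. f_equal. unfold Rsqr. nra. }
  pose proof (acos_bound (p / m)) as Hb.
  assert (Hpm : p = m * (p / m)) by (field; lra).
  assert (Hqm : q = m * (q / m)) by (field; lra).
  destruct (Rle_lt_dec 0 (q / m)) as [Hq|Hq].
  - exists (acos (p / m)). split; [lra|].
    unfold Cexpi. rewrite cos_acos, Hsin, Rabs_right by lra.
    apply injective_projections; simpl; lra.
  (* Strict positivity keeps the reflected angle strictly below 2 PI, as the half-open range of
     phases demands. *)
  - assert (Ha : 0 < acos (p / m)).
    { destruct (Rle_lt_or_eq_dec _ _ (proj1 Hb)) as [h|h]; [exact h|].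
      rewrite <- h, sin_0, Rabs_left in Hsin by lra. lra. }
    exists (2 * PI - acos (p / m)). split; [lra|].
    replace (2 * PI - acos (p / m)) with (- acos (p / m) + 2 * INR 1 * PI) by (simpl; ring).
    unfold Cexpi. rewrite cos_period, sin_period, cos_neg, sin_neg, cos_acos, Hsin, Rabs_left by lra.
    apply injective_projections; simpl; lra.
Qed.

(** * Finite sums over initial segments *)

Lemma Csum_ext (N : nat) (f g : nat -> Cx) :
  (forall i, (i < N)%nat -> f i = g i) -> Csum N f = Csum N g.
Proof.
  induction N as [|N IH]; intros H; simpl; [reflexivity|].
  rewrite IH, H by (try lia; intros; apply H; lia). reflexivity.
Qed.
Lemma Csum_0 (N : nat) (f : nat -> Cx) :
  (forall i, (i < N)%nat -> f i = C0) -> Csum N f = C0.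
Proof.
  induction N as [|N IH]; intros H; simpl; [reflexivity|].
  rewrite IH, H by (try lia; intros; apply H; lia). ring.
Qed.
Lemma Csum_add (N : nat) (f g : nat -> Cx) :
  Csum N (fun i => f i + g i)%Cx = (Csum N f + Csum N g)%Cx.
Proof. induction N as [|N IH]; simpl; [|rewrite IH]; ring. Qed.
Lemma Csum_mul_l (N : nat) (c : Cx) (f : nat -> Cx) :
  Csum N (fun i => c * f i)%Cx = (c * Csum N f)%Cx.
Proof. induction N as [|N IH]; simpl; [|rewrite IH]; ring. Qed.
Lemma Csum_mul_r (N : nat) (c : Cx) (f : nat -> Cx) :
  Csum N (fun i => f i * c)%Cx = (Csum N f * c)%Cx.
Proof. induction N as [|N IH]; simpl; [|rewrite IH]; ring. Qed.
Lemma Csum_conj (N : nat) (f : nat -> Cx) :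
  Cconj (Csum N f) = Csum N (fun i => Cconj (f i)).
Proof. induction N as [|N IH]; simpl; [apply Cconj_C0|]. now rewrite Cconj_add, IH. Qed.
Lemma Csum_swap (M N : nat) (f : nat -> nat -> Cx) :
  Csum M (fun i => Csum N (f i)) = Csum N (fun j => Csum M (fun i => f i j)).
Proof.
  induction M as [|M IH]; simpl.
  - symmetry. now apply Csum_0.
  - now rewrite IH, Csum_add.
Qed.
Lemma Csum_recl (N : nat) (f : nat -> Cx) :
  Csum (S N) f = (f O + Csum N (fun i => f (S i)))%Cx.
Proof.
  induction N as [|N IH]; [simpl; ring|].
  change (Csum (S (S N)) f) with (Csum (S N) f + f (S N))%Cx. rewrite IH. simpl. ring.
Qed.
Lemma Csum_single (N k : nat) (f : nat -> Cx) :
  (k < N)%nat -> (forall i, (i < N)%nat -> i <> k -> f i = C0) -> Csum N f = f k.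
Proof.
  induction N as [|N IH]; intros Hk H; [lia|]. simpl.
  destruct (Nat.eq_dec k N) as [->|Hne].
  - rewrite Csum_0 by (intros; apply H; lia). ring.
  - rewrite IH, (H N) by (try lia; intros; apply H; lia). ring.
Qed.
Lemma Csum_const (N : nat) (c : Cx) : Csum N (fun _ => c) = (RtoC (INR N) * c)%Cx.
Proof. induction N as [|N IH]; [cx_ring|]. rewrite S_INR, RtoC_add. simpl. rewrite IH.
  fold Cone. ring. Qed.
Lemma Csum_plus (M N : nat) (f : nat -> Cx) :
  Csum (M + N) f = (Csum M f + Csum N (fun i => f (M + i)%nat))%Cx.
Proof.
  induction N as [|N IH]; simpl; [rewrite Nat.add_0_r; ring|].
  rewrite Nat.add_succ_r; simpl. rewrite IH. ring.
Qed.
Lemma Csum_blocks (J n : nat) (f : nat -> Cx) :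
  Csum (J * n) f = Csum J (fun b => Csum n (fun s => f (b * n + s)%nat)).
Proof.
  induction J as [|J IH]; simpl; [reflexivity|].
  rewrite Nat.add_comm, Csum_plus, IH. reflexivity.
Qed.
Lemma Csum_Rsum_re (N : nat) (f : nat -> Cx) : Cre (Csum N f) = Rsum N (fun i => Cre (f i)).
Proof. induction N as [|N IH]; [reflexivity|]. simpl Csum; simpl Rsum. now rewrite Cre_add, IH. Qed.
Lemma Csum_RtoC (N : nat) (f : nat -> R) : Csum N (fun i => RtoC (f i)) = RtoC (Rsum N f).
Proof. induction N as [|N IH]; simpl; [reflexivity|]. now rewrite RtoC_add, IH. Qed.

Lemma Rsum_ext (N : nat) (f g : nat -> R) :
  (forall i, (i < N)%nat -> f i = g i) -> Rsum N f = Rsum N g.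
Proof.
  induction N as [|N IH]; intros H; simpl; [reflexivity|].
  rewrite IH, H by (try lia; intros; apply H; lia). reflexivity.
Qed.
Lemma Rsum_le (N : nat) (f g : nat -> R) :
  (forall i, (i < N)%nat -> f i <= g i) -> Rsum N f <= Rsum N g.
Proof.
  induction N as [|N IH]; intros H; simpl; [lra|].
  apply Rplus_le_compat; [apply IH; intros|]; apply H; lia.
Qed.
Lemma Rsum_add (N : nat) (f g : nat -> R) :
  Rsum N (fun i => f i + g i) = Rsum N f + Rsum N g.
Proof. induction N as [|N IH]; simpl; [|rewrite IH]; ring. Qed.
Lemma Rsum_mul_l (N : nat) (c : R) (f : nat -> R) :
  Rsum N (fun i => c * f i) = c * Rsum N f.
Proof. induction N as [|N IH]; simpl; [|rewrite IH]; ring. Qed.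
Lemma Rsum_const (N : nat) (c : R) : Rsum N (fun _ => c) = INR N * c.
Proof. induction N as [|N IH]; [simpl; ring|]. rewrite S_INR. simpl. rewrite IH. ring. Qed.
Lemma Rsum_ge0 (N : nat) (f : nat -> R) :
  (forall i, (i < N)%nat -> 0 <= f i) -> 0 <= Rsum N f.
Proof.
  intros H. apply Rle_trans with (Rsum N (fun _ => 0)); [|now apply Rsum_le].
  rewrite Rsum_const. lra.
Qed.
Lemma Rsum_ge_term (N k : nat) (f : nat -> R) :
  (forall i, (i < N)%nat -> 0 <= f i) -> (k < N)%nat -> f k <= Rsum N f.
Proof.
  induction N as [|N IH]; intros H Hk; [lia|]. simpl.
  pose proof (H N ltac:(lia)).
  pose proof (Rsum_ge0 N f ltac:(intros; apply H; lia)).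
  destruct (Nat.eq_dec k N) as [->|Hne]; [lra|].
  pose proof (IH ltac:(intros; apply H; lia) ltac:(lia)). lra.
Qed.
Lemma Rsum_recl (N : nat) (f : nat -> R) : Rsum (S N) f = f O + Rsum N (fun i => f (S i)).
Proof.
  induction N as [|N IH]; [simpl; ring|].
  change (Rsum (S (S N)) f) with (Rsum (S N) f + f (S N)). rewrite IH. simpl. ring.
Qed.

(** * Hermitian forms *)

Definition mulv (N : nat) (M : nat -> nat -> Cx) (v : nat -> Cx) (i : nat) : Cx :=
  Csum N (fun j => M i j * v j)%Cx.
Definition form (N : nat) (M : nat -> nat -> Cx) (v w : nat -> Cx) : Cx :=
  Csum N (fun i => Cconj (v i) * mulv N M w i)%Cx.
Definition hermitian (N : nat) (M : nat -> nat -> Cx) : Prop :=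
  forall i j, (i < N)%nat -> (j < N)%nat -> M j i = Cconj (M i j).
(** Stated through the real part, so that Schur complements can be formed without carrying Hermitian
    symmetry along; [hermitian] records that separately. *)
Definition posdef (N : nat) (M : nat -> nat -> Cx) : Prop :=
  forall v, (exists i, (i < N)%nat /\ v i <> C0) -> 0 < Cre (quad N M v).

Lemma quad_form (N : nat) (M : nat -> nat -> Cx) (v : nat -> Cx) :
  quad N M v = form N M v v.
Proof. unfold quad, form, mulv. apply Csum_ext; intros. now rewrite Csum_mul_l. Qed.

Lemma mulv_ext (N : nat) (M M' : nat -> nat -> Cx) (v v' : nat -> Cx) (i : nat) :
  (forall j, (j < N)%nat -> M i j = M' i j) -> (forall j, (j < N)%nat -> v j = v' j) ->
  mulv N M v i = mulv N M' v' i.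
Proof. intros HM Hv. apply Csum_ext; intros j Hj. now rewrite HM, Hv. Qed.

Lemma form_ext (N : nat) (M M' : nat -> nat -> Cx) (v v' w w' : nat -> Cx) :
  (forall i j, (i < N)%nat -> (j < N)%nat -> M i j = M' i j) ->
  (forall j, (j < N)%nat -> v j = v' j) -> (forall j, (j < N)%nat -> w j = w' j) ->
  form N M v w = form N M' v' w'.
Proof.
  intros HM Hv Hw. apply Csum_ext; intros i Hi. rewrite Hv by exact Hi. f_equal.
  apply mulv_ext; auto.
Qed.

Lemma quad_ext (N : nat) (M M' : nat -> nat -> Cx) (v v' : nat -> Cx) :
  (forall i j, (i < N)%nat -> (j < N)%nat -> M i j = M' i j) ->
  (forall j, (j < N)%nat -> v j = v' j) -> quad N M v = quad N M' v'.
Proof. intros HM Hv. rewrite !quad_form. now apply form_ext. Qed.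

Lemma mulv_lin (N : nat) (M : nat -> nat -> Cx) (a : Cx) (v w : nat -> Cx) (i : nat) :
  mulv N M (fun j => v j + a * w j)%Cx i = (mulv N M v i + a * mulv N M w i)%Cx.
Proof.
  unfold mulv. rewrite <- Csum_mul_l, <- Csum_add. apply Csum_ext; intros; ring.
Qed.

Lemma form_lin_r (N : nat) (M : nat -> nat -> Cx) (a : Cx) (u v w : nat -> Cx) :
  form N M u (fun j => v j + a * w j)%Cx = (form N M u v + a * form N M u w)%Cx.
Proof.
  unfold form. rewrite <- Csum_mul_l, <- Csum_add. apply Csum_ext; intros.
  rewrite mulv_lin. ring.
Qed.

Lemma form_lin_l (N : nat) (M : nat -> nat -> Cx) (a : Cx) (u v w : nat -> Cx) :
  form N M (fun j => v j + a * w j)%Cx u = (form N M v u + Cconj a * form N M w u)%Cx.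
Proof.
  unfold form. rewrite <- Csum_mul_l, <- Csum_add. apply Csum_ext; intros.
  rewrite Cconj_add, Cconj_mul. ring.
Qed.

Lemma form_hermitian (N : nat) (M : nat -> nat -> Cx) (v w : nat -> Cx) :
  hermitian N M -> form N M w v = Cconj (form N M v w).
Proof.
  intros H. unfold form, mulv. rewrite Csum_conj.
  transitivity (Csum N (fun i => Csum N (fun j => Cconj (w i) * (M i j * v j)))%Cx).
  { apply Csum_ext; intros. now rewrite Csum_mul_l. }
  rewrite Csum_swap. apply Csum_ext; intros i Hi.
  rewrite Cconj_mul, Csum_conj, <- Csum_mul_l. apply Csum_ext; intros j Hj.
  rewrite (H i j), Cconj_mul, Cconj_conj by assumption. ring.
Qed.

Lemma quad_hermitian_real (N : nat) (M : nat -> nat -> Cx) (v : nat -> Cx) :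
  hermitian N M -> quad N M v = RtoC (Cre (quad N M v)).
Proof.
  intros H. rewrite quad_form. pose proof (form_hermitian N M v v H) as E.
  destruct (form N M v v) as [p q]. unfold Cconj in E; simpl in E.
  injection E as E. unfold RtoC, Cre; simpl. f_equal. lra.
Qed.

(** Padding with zeros is how a leading principal block inherits positivity, and how a single
    diagonal entry is read off from a form. *)
Lemma quad_restrict (N N' : nat) (M : nat -> nat -> Cx) (v : nat -> Cx) :
  (N' <= N)%nat ->
  quad N M (fun i => if Nat.ltb i N' then v i else C0) = quad N' M v.
Proof.
  intros H. rewrite !quad_form. unfold form, mulv.
  replace N with (N' + (N - N'))%nat by lia. rewrite Csum_plus.
  rewrite (Csum_0 (N - N')).
  2:{ intros i _. destruct (Nat.ltb_spec (N' + i) N'); [lia|]. rewrite Cconj_C0. ring. }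
  rewrite (Csum_ext N' _ (fun i => Cconj (v i) * mulv N' M v i)%Cx); [unfold mulv; ring|].
  intros i Hi. destruct (Nat.ltb_spec i N'); [|lia]. f_equal. unfold mulv.
  rewrite Csum_plus, (Csum_0 (N - N')).
  2:{ intros j _. destruct (Nat.ltb_spec (N' + j) N'); [lia|]. ring. }
  rewrite (Csum_ext N' _ (fun j => M i j * v j)%Cx); [ring|].
  intros j Hj. destruct (Nat.ltb_spec j N'); [reflexivity|lia].
Qed.

Lemma posdef_le (N N' : nat) (M : nat -> nat -> Cx) :
  (N' <= N)%nat -> posdef N M -> posdef N' M.
Proof.
  intros H HP v [i [Hi Hv]]. rewrite <- (quad_restrict N N') by exact H.
  apply HP. exists i. split; [lia|]. destruct (Nat.ltb_spec i N'); [exact Hv|lia].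
Qed.

Lemma posdef_ge0 (N : nat) (M : nat -> nat -> Cx) (v : nat -> Cx) :
  posdef N M -> 0 <= Cre (quad N M v).
Proof.
  intros HP. destruct (classic (exists i, (i < N)%nat /\ v i <> C0)) as [H|H].
  - left; now apply HP.
  - right. rewrite quad_form. unfold form. rewrite Csum_0; [reflexivity|].
    intros i Hi. replace (v i) with C0; [rewrite Cconj_C0; ring|].
    symmetry. apply NNPP; intros Hv. apply H. now exists i.
Qed.

(* Gaussian elimination: the Schur complement of the last diagonal entry is again positive,
   since its form is the restriction of the form to vectors killed by the last row. *)
Lemma posdef_solve (N : nat) (M : nat -> nat -> Cx) (z : nat -> Cx) :
  posdef N M -> exists y, forall i, (i < N)%nat -> mulv N M y i = z i.
Proof.
  revert M z. induction N as [|N IH]; intros M z HP; [exists z; lia|].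
  (* The pivot is the value of the form at the last basis vector, so its real part is positive. *)
  assert (Ha : M N N <> C0).
  { intros Ha.
    pose proof (HP (fun i => if Nat.eqb i N then Cone else C0)
      ltac:(exists N; split; [lia|rewrite Nat.eqb_refl; intros E; apply (f_equal fst) in E;
            simpl in E; lra])) as H.
    rewrite quad_form in H. unfold form, mulv in H.
    rewrite (Csum_single _ N) in H; [|lia|].
    2:{ intros i _ Hi. destruct (Nat.eqb_spec i N); [lia|]. rewrite Cconj_C0. ring. }
    rewrite (Csum_single _ N) in H; [|lia|].
    2:{ intros i _ Hi. destruct (Nat.eqb_spec i N); [lia|]. ring. }
    rewrite Ha, Nat.eqb_refl in H. cx_unfold. lra. }
  destruct (Cmul_inv_ex _ Ha) as [b Hb].
  set (Sc := fun i j => (M i j - M i N * b * M N j)%Cx).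
  assert (HS : posdef N Sc).
  { intros v [i [Hi Hv]].
    (* With this last coordinate, row [N] of [M] annihilates [v']. *)
    set (l := (- (b * mulv N M v N))%Cx).
    set (v' := fun i => if Nat.ltb i N then v i else l).
    assert (E1 : forall k, mulv (S N) M v' k = (mulv N M v k + M k N * l)%Cx).
    { intros k. unfold mulv; simpl. f_equal.
      - apply Csum_ext; intros j Hj. unfold v'. destruct (Nat.ltb_spec j N); [reflexivity|lia].
      - unfold v'. now rewrite Nat.ltb_irrefl. }
    replace (quad N Sc v) with (quad (S N) M v').
    { apply HP. exists i. split; [lia|]. unfold v'. destruct (Nat.ltb_spec i N); [exact Hv|lia]. }
    rewrite !quad_form. unfold form; simpl. rewrite (E1 N).
    replace (mulv N M v N + M N N * l)%Cx with C0.
    2:{ unfold l. transitivity (mulv N M v N - (M N N * b) * mulv N M v N)%Cx; [rewrite Hb|]; ring. }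
    transitivity (Csum N (fun i0 => Cconj (v' i0) * mulv (S N) M v' i0)%Cx); [ring|].
    apply Csum_ext; intros k Hk. f_equal.
    - unfold v'. destruct (Nat.ltb_spec k N); [reflexivity|lia].
    - rewrite E1. unfold l. transitivity (mulv N M v k + (- (M k N * b)) * mulv N M v N)%Cx; [ring|].
      unfold mulv. rewrite <- Csum_mul_l, <- Csum_add. apply Csum_ext; intros. unfold Sc. ring. }
  destruct (IH Sc (fun i => z i - M i N * b * z N)%Cx HS) as [y Hy].
  (* Back substitution: the last equation solved for the last unknown. *)
  set (l := (b * (z N - mulv N M y N))%Cx).
  exists (fun i => if Nat.ltb i N then y i else l).
  assert (E1 : forall k, mulv (S N) M (fun i => if Nat.ltb i N then y i else l) k
                         = (mulv N M y k + M k N * l)%Cx).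
  { intros k. unfold mulv; simpl. f_equal.
    - apply Csum_ext; intros j Hj. destruct (Nat.ltb_spec j N); [reflexivity|lia].
    - now rewrite Nat.ltb_irrefl. }
  intros i Hi. rewrite E1. unfold l. destruct (Nat.eq_dec i N) as [->|Hne].
  - transitivity (mulv N M y N + (M N N * b) * (z N - mulv N M y N))%Cx; [ring|]. rewrite Hb. ring.
  - pose proof (Hy i ltac:(lia)) as H.
    assert (E2 : mulv N Sc y i = (mulv N M y i - M i N * b * mulv N M y N)%Cx).
    { transitivity (mulv N M y i + (- (M i N * b)) * mulv N M y N)%Cx; [|ring].
      unfold mulv. rewrite <- Csum_mul_l, <- Csum_add. apply Csum_ext; intros. unfold Sc. ring. }
    rewrite E2 in H.
    transitivity ((mulv N M y i - M i N * b * mulv N M y N) + M i N * b * z N)%Cx; [ring|].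
    rewrite H. ring.
Qed.

(** * Positive definite Toeplitz matrices *)

(** Off the diagonal the symmetry is built into [Toep]; on the diagonal it says that [u O] is its
    own conjugate, whence the hypothesis. *)
Lemma Toep_hermitian (N : nat) (u : nat -> Cx) : Cim (u O) = 0 -> hermitian N (Toep u).
Proof.
  intros Hu i j _ _. unfold Toep.
  destruct (Nat.leb_spec i j), (Nat.leb_spec j i); try lia.
  - replace (j - i)%nat with O by lia. replace (i - j)%nat with O by lia.
    destruct (u O) as [p q]. unfold Cim in Hu; simpl in Hu. subst q. cx_ring.
  - now rewrite Cconj_conj.
  - reflexivity.
Qed.

(** Subtraction is truncated, so the two bounds together say |i - j| < m. *)
Lemma Toep_ext (u u' : nat -> Cx) (m i j : nat) :
  (forall k, (k < m)%nat -> u k = u' k) -> (i - j < m)%nat -> (j - i < m)%nat ->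
  Toep u i j = Toep u' i j.
Proof. intros H Hi Hj. unfold Toep. destruct (Nat.leb j i); now rewrite H. Qed.

Lemma Csum_border (m : nat) (f : nat -> Cx) :
  Csum (S (S m)) f = (f O + Csum m (fun i => f (S i)) + f (S m))%Cx.
Proof. rewrite Csum_recl. simpl. ring. Qed.

(** Vectors of length m + 2 are written (a, v, b) because, in a Toeplitz matrix of that size, only
    the two corner entries pairing the ends [a] and [b] involve the coefficient of index m + 1. *)
Definition border (m : nat) (a : Cx) (v : nat -> Cx) (b : Cx) (t : nat) : Cx :=
  match t with
  | O => a
  | S i => if Nat.ltb i m then v i else b
  end.

Lemma border_mid (m : nat) (a b : Cx) (v : nat -> Cx) (i : nat) :
  (i < m)%nat -> border m a v b (S i) = v i.
Proof. intros H. simpl. destruct (Nat.ltb_spec i m); [reflexivity|lia]. Qed.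
Lemma border_last (m : nat) (a b : Cx) (v : nat -> Cx) : border m a v b (S m) = b.
Proof. simpl. now rewrite Nat.ltb_irrefl. Qed.

Lemma mulv_border (m : nat) (M : nat -> nat -> Cx) (a b : Cx) (v : nat -> Cx) (i : nat) :
  mulv (S (S m)) M (border m a v b) i
  = (M i O * a + Csum m (fun j => M i (S j) * v j) + M i (S m) * b)%Cx.
Proof.
  unfold mulv. rewrite Csum_border, border_last. f_equal. f_equal.
  apply Csum_ext; intros j Hj. now rewrite border_mid.
Qed.

Lemma form_border (m : nat) (M : nat -> nat -> Cx) (a b : Cx) (v w : nat -> Cx) :
  form (S (S m)) M (border m a v b) w
  = (Cconj a * mulv (S (S m)) M w O
     + Csum m (fun i => Cconj (v i) * mulv (S (S m)) M w (S i))
     + Cconj b * mulv (S (S m)) M w (S m))%Cx.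
Proof.
  unfold form at 1. rewrite Csum_border, border_last. f_equal. f_equal.
  apply Csum_ext; intros j Hj. now rewrite border_mid.
Qed.

(* With A = (1,y,0) and W = (0,w,1) chosen orthogonal, for the bordered form, to all vectors
   (0,e,0), the new entry c is chosen so that also A and W are orthogonal; the bordered form is
   then a sum of three positive forms. *)
Lemma posdef_Toep_extend (m : nat) (u : nat -> Cx) :
  Cim (u O) = 0 -> posdef (S m) (Toep u) ->
  exists c, posdef (S (S m)) (Toep (fun k => if Nat.eqb k (S m) then c else u k)).
Proof.
  intros Hu HP.
  assert (HPm : posdef m (Toep u)) by (apply (posdef_le (S m)); [lia|exact HP]).
  (* By shift invariance the middle rows and columns 1, ..., m again form [Toep u], so [y] and [w]
     solve systems with the same matrix of size [m]. *)
  destruct (posdef_solve m (Toep u) (fun i => - Toep u (S i) O)%Cx HPm) as [y Hy].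
  destruct (posdef_solve m (Toep u) (fun i => - Toep u (S i) (S m))%Cx HPm) as [w Hw].
  (* The corner entry in row 0 and column m + 1 is the conjugate of the new coefficient; this value
     makes row 0 annihilate [W]. *)
  exists (- Cconj (Csum m (fun j => Toep u O (S j) * w j)))%Cx.
  set (c := (- Cconj _)%Cx). set (u' := fun k => if Nat.eqb k (S m) then c else u k).
  set (T := Toep u').
  assert (Hu' : forall k, (k < S m)%nat -> u' k = u k).
  { intros k Hk. unfold u'. destruct (Nat.eqb_spec k (S m)); [lia|reflexivity]. }
  assert (HT : forall i j, (i - j < S m)%nat -> (j - i < S m)%nat -> T i j = Toep u i j).
  { intros i j H1 H2. now apply (Toep_ext _ _ (S m)). }
  assert (HH : hermitian (S (S m)) T).
  { apply Toep_hermitian. now rewrite Hu' by lia. }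
  set (A := border m Cone y C0). set (W := border m C0 w Cone).
  assert (TA : forall i, (i < m)%nat -> mulv (S (S m)) T A (S i) = C0).
  { intros i Hi. unfold A. rewrite mulv_border, HT by lia.
    transitivity (Toep u (S i) O + mulv m (Toep u) y i)%Cx.
    - unfold mulv. rewrite (Csum_ext m _ (fun j => Toep u i j * y j)%Cx); [ring|].
      intros j Hj. now rewrite HT by lia.
    - rewrite Hy by exact Hi. ring. }
  assert (TW : forall i, (i < m)%nat -> mulv (S (S m)) T W (S i) = C0).
  { intros i Hi. unfold W. rewrite mulv_border, (HT _ (S m)) by lia.
    transitivity (Toep u (S i) (S m) + mulv m (Toep u) w i)%Cx.
    - unfold mulv. rewrite (Csum_ext m _ (fun j => Toep u i j * w j)%Cx); [ring|].
      intros j Hj. now rewrite HT by lia.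
    - rewrite Hw by exact Hi. ring. }
  assert (TW0 : mulv (S (S m)) T W O = C0).
  { unfold W. rewrite mulv_border.
    replace (T O (S m)) with (- Csum m (fun j => Toep u O (S j) * w j))%Cx.
    2:{ unfold T, Toep at 2; simpl. unfold u'. rewrite Nat.eqb_refl. unfold c.
        now rewrite Cconj_opp, Cconj_conj. }
    rewrite (Csum_ext m _ (fun j => Toep u O (S j) * w j)%Cx); [ring|].
    intros j Hj. now rewrite HT by lia. }
  assert (AW : form (S (S m)) T A W = C0).
  { unfold A at 1. rewrite form_border, TW0, Cconj_C0, Csum_0; [ring|].
    intros i Hi. rewrite TW by exact Hi. ring. }
  intros v Hv.
  (* The end coordinates of [v] dictate the multiples of [A] and [W]; what remains is supported in
     the middle. *)
  set (al := v O). set (be := v (S m)).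
  set (e := fun i => (v (S i) - al * y i - be * w i)%Cx).
  set (E := border m C0 e C0).
  assert (EA : form (S (S m)) T E A = C0).
  { unfold E. rewrite form_border, Cconj_C0, Csum_0; [ring|].
    intros i Hi. rewrite TA by exact Hi. ring. }
  assert (EW : form (S (S m)) T E W = C0).
  { unfold E. rewrite form_border, Cconj_C0, Csum_0; [ring|].
    intros i Hi. rewrite TW by exact Hi. ring. }
  assert (Hdec : forall t, (t < S (S m))%nat -> v t = ((E t + al * A t) + be * W t)%Cx).
  { intros [|i] Hi; [simpl; unfold al; ring|].
    destruct (Nat.eq_dec i m) as [->|Hne].
    - unfold E, A, W. rewrite !border_last. unfold be. ring.
    - unfold E, A, W. rewrite !border_mid by lia. unfold e. ring. }
  assert (HQ : quad (S (S m)) T v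
    = (quad (S (S m)) T E + Cconj al * al * quad (S (S m)) T A
       + Cconj be * be * quad (S (S m)) T W)%Cx).
  { rewrite !quad_form. rewrite (form_ext _ T T v _ v _ ltac:(reflexivity) Hdec Hdec).
    rewrite form_lin_l, !form_lin_r, !form_lin_l.
    rewrite (form_hermitian _ _ E A), (form_hermitian _ _ E W), (form_hermitian _ _ A W) by exact HH.
    rewrite EA, EW, AW, Cconj_C0. ring. }
  assert (QE : quad (S (S m)) T E = quad m (Toep u) e).
  { rewrite !quad_form. unfold E at 1. rewrite form_border, Cconj_C0. unfold form.
    rewrite (Csum_ext m _ (fun i => Cconj (e i) * mulv m (Toep u) e i)%Cx); [ring|].
    intros i Hi. f_equal. unfold E. rewrite mulv_border. unfold mulv.
    rewrite (Csum_ext m _ (fun j => Toep u i j * e j)%Cx); [ring|].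
    intros j Hj. now rewrite HT by lia. }
  (* [A] vanishes at the last index and [W] at the first, so their forms only see the leading and
     the trailing block of size m + 1. Both blocks equal [Toep u], where positivity is the
     hypothesis. *)
  assert (QA : quad (S (S m)) T A = quad (S m) (Toep u) A).
  { rewrite !quad_form. unfold form.
    change (Csum (S (S m)) ?f) with (Csum (S m) f + f (S m))%Cx. cbv beta.
    replace (A (S m)) with C0 by (symmetry; apply border_last). rewrite Cconj_C0.
    rewrite (Csum_ext (S m) _ (fun i => Cconj (A i) * mulv (S m) (Toep u) A i)%Cx); [ring|].
    intros i Hi. f_equal. unfold mulv.
    change (Csum (S (S m)) ?f) with (Csum (S m) f + f (S m))%Cx. cbv beta.
    replace (A (S m)) with C0 by (symmetry; apply border_last).
    rewrite (Csum_ext (S m) _ (fun j => Toep u i j * A j)%Cx); [ring|].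
    intros j Hj. now rewrite HT by lia. }
  assert (QW : quad (S (S m)) T W = quad (S m) (Toep u) (fun i => W (S i))).
  { rewrite !quad_form. unfold form. rewrite Csum_recl.
    change (W O) with C0. rewrite Cconj_C0.
    rewrite (Csum_ext (S m) _ (fun i => Cconj (W (S i)) * mulv (S m) (Toep u) (fun i => W (S i)) i)%Cx);
      [ring|].
    intros i Hi. f_equal. unfold mulv. rewrite Csum_recl. change (W O) with C0.
    rewrite (Csum_ext (S m) _ (fun j => Toep u i j * W (S j))%Cx); [ring|].
    intros j Hj. now rewrite HT by lia. }
  assert (Cone_neq : Cone <> C0) by (intros h; apply (f_equal fst) in h; simpl in h; lra).
  assert (PA : 0 < Cre (quad (S (S m)) T A)).
  { rewrite QA. apply HP. exists O. split; [lia|exact Cone_neq]. }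
  assert (PW : 0 < Cre (quad (S (S m)) T W)).
  { rewrite QW. apply HP. exists m. split; [lia|]. unfold W. now rewrite border_last. }
  pose proof (posdef_ge0 m _ e HPm) as PE. rewrite <- QE in PE.
  rewrite HQ, !Cconj_mul_self.
  pose proof (Cnorm2_ge0 al) as Nal. pose proof (Cnorm2_ge0 be) as Nbe.
  assert (Hre : forall (p q r : Cx) (a b : R),
     Cre (p + RtoC a * q + RtoC b * r)%Cx = Cre p + a * Cre q + b * Cre r)
    by (intros; cx_unfold; ring).
  rewrite Hre.
  (* A nonzero end coordinate makes its own term strictly positive; if both vanish, [e] is the
     middle part of [v] and is nonzero. *)
  destruct (Cx_eq_dec al C0) as [Hal|Hal].
  2:{ pose proof (Cnorm2_gt0 _ Hal). nra. }
  destruct (Cx_eq_dec be C0) as [Hbe|Hbe].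
  2:{ pose proof (Cnorm2_gt0 _ Hbe). nra. }
  assert (0 < Cre (quad (S (S m)) T E)); [|nra].
  rewrite QE. apply HPm. destruct Hv as [[|i] [Hi Hvi]]; [now elim Hvi|].
  exists i. destruct (Nat.eq_dec i m) as [->|Hne]; [now elim Hvi|].
  split; [lia|]. unfold e. rewrite Hal, Hbe. intros h; apply Hvi. rewrite <- h. ring.
Qed.

Lemma posdef_Toep_extend_to (n N : nat) (u : nat -> Cx) :
  (1 <= n)%nat -> (n <= N)%nat -> Cim (u O) = 0 -> posdef n (Toep u) ->
  exists u', (forall k, (k < n)%nat -> u' k = u k) /\ posdef N (Toep u').
Proof.
  intros Hn HN Hu HP. induction HN as [|N HN IH]; [now exists u|].
  destruct IH as [u' [Hag HP']].
  destruct N as [|m]; [lia|].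
  destruct (posdef_Toep_extend m u') as [c Hc]; [now rewrite Hag by lia|exact HP'|].
  exists (fun k => if Nat.eqb k (S m) then c else u' k). split; [|exact Hc].
  intros k Hk. destruct (Nat.eqb_spec k (S m)); [lia|now apply Hag].
Qed.

(** * Vandermonde decomposition *)

Definition wave (f : R) (t : nat) : Cx := Cexpi (2 * PI * f * INR t).

Lemma wave_add (f : R) (s t : nat) : wave f (s + t) = (wave f s * wave f t)%Cx.
Proof. unfold wave. rewrite <- Cexpi_add, plus_INR. f_equal. ring. Qed.
Lemma wave_0 (f : R) : wave f 0 = Cone.
Proof. unfold wave. simpl. now rewrite Rmult_0_r, Cexpi_0. Qed.
Lemma wave_conj_self (f : R) (t : nat) : (wave f t * Cconj (wave f t))%Cx = Cone.
Proof.
  unfold wave. rewrite <- Cexpi_opp, <- Cexpi_add, Rplus_opp_r. apply Cexpi_0.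
Qed.

Lemma geometric_Cexpi (L : nat) (th : R) :
  ((Cexpi th - Cone) * Csum L (fun m => Cexpi (th * INR m)))%Cx = (Cexpi (th * INR L) - Cone)%Cx.
Proof.
  induction L as [|L IH].
  - simpl. rewrite Rmult_0_r, Cexpi_0. ring.
  - rewrite S_INR. simpl Csum.
    transitivity ((Cexpi th - Cone) * Csum L (fun m => Cexpi (th * INR m))
                  + (Cexpi th - Cone) * Cexpi (th * INR L))%Cx; [ring|].
    rewrite IH, Rmult_plus_distr_l, Rmult_1_r, Cexpi_add. ring.
Qed.

(** For a <> p the sum is geometric with ratio exp(i th). Its L-th power is 1, while the ratio
    itself is not, because 0 < |a - p| < L. *)
Lemma dft_orthogonal (L a p : nat) :
  (a < L)%nat -> (p < L)%nat ->
  Csum L (fun m => wave (INR m / INR L) a * Cconj (wave (INR m / INR L) p))%Cx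
  = if Nat.eqb a p then RtoC (INR L) else C0.
Proof.
  intros Ha Hp.
  assert (HL : 0 < INR L) by (apply lt_0_INR; lia).
  destruct (Nat.eqb_spec a p) as [->|Hne].
  - rewrite (Csum_ext L _ (fun _ => Cone)) by (intros; apply wave_conj_self).
    rewrite Csum_const. ring.
  - set (th := 2 * PI * ((INR a - INR p) / INR L)).
    rewrite (Csum_ext L _ (fun m => Cexpi (th * INR m))).
    2:{ intros m _. unfold wave. rewrite <- Cexpi_opp, <- Cexpi_add. f_equal.
        unfold th. field. lra. }
    pose proof (geometric_Cexpi L th) as G.
    replace (Cexpi (th * INR L)) with Cone in G.
    2:{ replace (th * INR L) with (2 * PI * INR a + - (2 * PI * INR p)) by (unfold th; field; lra).
        rewrite Cexpi_add, Cexpi_opp, !Cexpi_2PI_INR, Cconj_Cone. ring. }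
    apply (Cmul_eq0 (Cexpi th - Cone)%Cx); [rewrite G; ring|].
    intros H. assert (H1 : Cexpi th = Cone).
    { transitivity ((Cexpi th - Cone) + Cone)%Cx; [ring|]. rewrite H; ring. }
    pose proof PI_RGT_0. pose proof (pos_INR a). pose proof (pos_INR p).
    pose proof (lt_INR _ _ Ha). pose proof (lt_INR _ _ Hp).
    assert (Hd : forall d, 0 < d < INR L -> 0 < 2 * PI * (d / INR L) < 2 * PI).
    { intros d [Hd1 Hd2]. assert (0 < d / INR L) by (now apply Rdiv_lt_0_compat).
      assert (d / INR L < 1). { apply (Rmult_lt_reg_r (INR L)); [lra|]. unfold Rdiv.
        rewrite Rmult_assoc, Rinv_l by lra. lra. }
      split; nra. }
    destruct (Nat.lt_ge_cases p a) as [Hlt|Hge].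
    + pose proof (lt_INR _ _ Hlt).
      apply (Cexpi_neq1 th); [apply Hd; lra|exact H1].
    + assert (Hlt : (a < p)%nat) by lia. pose proof (lt_INR _ _ Hlt).
      apply (Cexpi_neq1 (- th)).
      * replace (- th) with (2 * PI * ((INR p - INR a) / INR L)) by (unfold th; field; lra).
        apply Hd; lra.
      * rewrite Cexpi_opp, H1. apply Cconj_Cone.
Qed.

(** N - k is the length of the k-th subdiagonal of a matrix of size N; this count is the source of
    the Fejer factor. *)
Lemma Csum_shift_count (N k : nat) (c : Cx) : (k <= N)%nat ->
  Csum N (fun q => if Nat.ltb (q + k) N then c else C0) = (RtoC (INR N - INR k) * c)%Cx.
Proof.
  intros Hk. rewrite <- minus_INR by exact Hk.
  replace N with ((N - k) + k)%nat at 1 by lia. rewrite Csum_plus.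
  rewrite (Csum_ext (N - k) _ (fun _ => c)).
  2:{ intros i Hi. destruct (Nat.ltb_spec (i + k) N); [reflexivity|lia]. }
  rewrite (Csum_0 k), Csum_const; [ring|].
  intros i Hi. destruct (Nat.ltb_spec (N - k + i + k) N); [lia|reflexivity].
Qed.

(* The values of the Fejer mean of the symbol on the grid m/(2N) are the numbers
   a(f)^* T a(f) / N, hence nonnegative; 2N points suffice to avoid aliasing. *)
Lemma fejer_weights (N : nat) (u : nat -> Cx) :
  (1 <= N)%nat -> Cim (u O) = 0 -> posdef N (Toep u) ->
  exists w : nat -> R, (forall m, 0 <= w m) /\
    forall k, (k < N)%nat ->
      Csum (2 * N) (fun m => RtoC (w m) * wave (INR m / INR (2 * N)) k)%Cx
      = (RtoC ((INR N - INR k) / INR N) * u k)%Cx.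
Proof.
  intros HN Hu HP. set (L := (2 * N)%nat). set (e := fun m => wave (INR m / INR L)).
  assert (HNp : 0 < INR N) by (apply lt_0_INR; lia).
  assert (HLp : 0 < INR L) by (apply lt_0_INR; lia).
  (* The factor 1/N normalises the Fejer mean, and 1/L the discrete Fourier sum. *)
  set (g := / (INR N * INR L)).
  assert (Hg : 0 < g) by (apply Rinv_0_lt_compat; nra).
  exists (fun m => g * Cre (quad N (Toep u) (e m))). split.
  { intros m. apply Rmult_le_pos; [lra|]. now apply posdef_ge0. }
  intros k Hk.
  (* Multiplying by the wave at [k] turns the index [q] into q + k. Summation over the grid then
     selects p = q + k, where the Toeplitz entry is [u k]. *)
  rewrite (Csum_ext L _ (fun m => RtoC g * Csum N (fun q => Csum N (fun p =>
     Toep u p q * (e m (q + k)%nat * Cconj (e m p)))))%Cx).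
  2:{ intros m _. rewrite RtoC_mul, <- quad_hermitian_real by (now apply Toep_hermitian).
      fold (e m). unfold quad. rewrite Csum_swap, <- !Csum_mul_l, <- Csum_mul_r.
      apply Csum_ext; intros q Hq. rewrite <- !Csum_mul_l, <- Csum_mul_r.
      apply Csum_ext; intros p Hp. unfold e. rewrite wave_add. ring. }
  rewrite Csum_mul_l, Csum_swap.
  rewrite (Csum_ext N _ (fun q => if Nat.ltb (q + k) N then RtoC (INR L) * u k else C0)%Cx).
  - rewrite Csum_shift_count by lia.
    transitivity (RtoC (g * (INR N - INR k) * INR L) * u k)%Cx; [rewrite !RtoC_mul; ring|].
    f_equal. f_equal. unfold g. field. lra.
  - intros q Hq. rewrite Csum_swap.
    rewrite (Csum_ext N _ (fun p => Toep u p q * (if Nat.eqb (q + k) p then RtoC (INR L) else C0))%Cx).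
    2:{ intros p Hp. rewrite Csum_mul_l. unfold e. rewrite dft_orthogonal by (unfold L; lia).
        reflexivity. }
    destruct (Nat.ltb_spec (q + k) N) as [h|h].
    + rewrite (Csum_single N (q + k)%nat); [|exact h|].
      * rewrite Nat.eqb_refl. unfold Toep. destruct (Nat.leb_spec q (q + k)); [|lia].
        replace (q + k - q)%nat with k by lia. ring.
      * intros i _ Hi. destruct (Nat.eqb_spec (q + k) i); [lia|]. ring.
    + apply Csum_0. intros i Hi. destruct (Nat.eqb_spec (q + k) i); [lia|]. ring.
Qed.

(** * Moduli and entrywise bounds on quadratic forms *)

Lemma Cmod_mul (a b : Cx) : Cmod (a * b)%Cx = Cmod a * Cmod b.
Proof.
  unfold Cmod. rewrite <- sqrt_mult by (apply Cnorm2_ge0). f_equal. cx_unfold. ring.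
Qed.
Lemma Cmod_conj (a : Cx) : Cmod (Cconj a) = Cmod a.
Proof. unfold Cmod. f_equal. cx_unfold. ring. Qed.
Lemma Cre_ge_Cmod (a : Cx) : - Cmod a <= Cre a.
Proof.
  pose proof (Cmod_ge0 a). pose proof (Cmod_sqr a) as H1. unfold Cnorm2 in H1. nra.
Qed.

(** Each term is at least -d |v_i| |v_j|, and 2 |v_i| |v_j| <= |v_i|^2 + |v_j|^2; the double sum of
    the squares gives the factor n. *)
Lemma quad_ge_entries (n : nat) (M : nat -> nat -> Cx) (d : R) (v : nat -> Cx) :
  (forall i j, (i < n)%nat -> (j < n)%nat -> Cmod (M i j) <= d) ->
  - (d * INR n * Rsum n (fun i => Cnorm2 (v i))) <= Cre (quad n M v).
Proof.
  intros H. unfold quad. rewrite Csum_Rsum_re.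
  apply Rle_trans with
    (Rsum n (fun i => Rsum n (fun j => - (d / 2) * (Cnorm2 (v i) + Cnorm2 (v j))))).
  - right. set (S := Rsum n (fun i => Cnorm2 (v i))).
    rewrite (Rsum_ext n _ (fun i => (- (d / 2) * INR n) * Cnorm2 (v i) + - (d / 2) * S)).
    + rewrite Rsum_add, Rsum_mul_l, Rsum_const. fold S. field.
    + intros i _. rewrite Rsum_mul_l, Rsum_add, Rsum_const. fold S. ring.
  - apply Rsum_le; intros i Hi. rewrite Csum_Rsum_re. apply Rsum_le; intros j Hj.
    eapply Rle_trans; [|apply Cre_ge_Cmod]. rewrite !Cmod_mul, Cmod_conj.
    rewrite <- !Cmod_sqr. pose proof (H i j Hi Hj). pose proof (Cmod_ge0 (M i j)).
    pose proof (Cmod_ge0 (v i)). pose proof (Cmod_ge0 (v j)).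
    assert (Cmod (v i) * (Cmod (M i j) * Cmod (v j)) <= d * (Cmod (v i) * Cmod (v j))).
    { replace (Cmod (v i) * (Cmod (M i j) * Cmod (v j)))
        with (Cmod (M i j) * (Cmod (v i) * Cmod (v j))) by ring.
      apply Rmult_le_compat_r; [apply Rmult_le_pos|]; assumption. }
    assert (0 <= d * (Cmod (v i) - Cmod (v j)) ^ 2) by (apply Rmult_le_pos; [lra|apply pow2_ge_0]).
    nra.
Qed.

Lemma Toep_add (u v : nat -> Cx) (i j : nat) :
  Toep (fun k => u k + v k)%Cx i j = (Toep u i j + Toep v i j)%Cx.
Proof. unfold Toep. destruct (Nat.leb j i); [reflexivity|apply Cconj_add]. Qed.

Lemma quad_add (n : nat) (M M' : nat -> nat -> Cx) (v : nat -> Cx) :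
  quad n (fun i j => M i j + M' i j)%Cx v = (quad n M v + quad n M' v)%Cx.
Proof.
  unfold quad. rewrite <- Csum_add. apply Csum_ext; intros. rewrite <- Csum_add.
  apply Csum_ext; intros. ring.
Qed.

Lemma Rsum_norm2_gt0 (n : nat) (v : nat -> Cx) :
  (exists i, (i < n)%nat /\ v i <> C0) -> 0 < Rsum n (fun i => Cnorm2 (v i)).
Proof.
  intros [i [Hi Hv]]. apply Rlt_le_trans with (Cnorm2 (v i)); [now apply Cnorm2_gt0|].
  apply (Rsum_ge_term n i (fun i => Cnorm2 (v i))); [|exact Hi]. intros; apply Cnorm2_ge0.
Qed.

(* Undoing the Fejer factor (N-k)/N perturbs the matrix by O(1/N). *)
Lemma posdef_Toep_unwindow (n : nat) (u : nat -> Cx) (eps : R) :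
  0 < eps ->
  (forall v, eps * Rsum n (fun i => Cnorm2 (v i)) <= Cre (quad n (Toep u) v)) ->
  exists N, (n < N)%nat /\
    posdef n (Toep (fun k => RtoC (INR N / (INR N - INR k)) * u k)%Cx).
Proof.
  intros He Hq. set (B := Rsum n (fun k => Cmod (u k))).
  assert (HB : 0 <= B) by (apply Rsum_ge0; intros; apply Cmod_ge0).
  assert (HBk : forall k, (k < n)%nat -> Cmod (u k) <= B).
  { intros k Hk. apply (Rsum_ge_term n k (fun k => Cmod (u k))); [intros; apply Cmod_ge0|exact Hk]. }
  pose proof (pos_INR n) as Hn0.
  (* For N = n + K and k < n one has N - k >= K, so the correction k/(N - k) u_k has modulus at most
     d = B n / K. The choice of [K] is exactly what makes d n < eps. *)
  destruct (INR_unbounded ((B * INR n * INR n) / eps)) as [K HK].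
  assert (HKp : 0 < INR K).
  { eapply Rle_lt_trans; [|exact HK]. apply Rmult_le_pos; [|left; now apply Rinv_0_lt_compat].
    repeat apply Rmult_le_pos; assumption. }
  assert (HK1 : (1 <= K)%nat). { destruct K; [simpl in HKp; lra|lia]. }
  set (N := (n + K)%nat). exists N. split; [unfold N; lia|].
  set (d := B * INR n / INR K).
  assert (Hd : d * INR n < eps).
  { unfold d. apply (Rmult_lt_reg_r (INR K)); [exact HKp|].
    replace (B * INR n / INR K * INR n * INR K) with (B * INR n * INR n) by (field; lra).
    apply (Rmult_lt_compat_l eps) in HK; [|exact He].
    replace (eps * (B * INR n * INR n / eps)) with (B * INR n * INR n) in HK by (field; lra). lra. }
  assert (HNk : forall k, (k < n)%nat -> INR K <= INR N - INR k).
  { intros k Hk. apply lt_INR in Hk. unfold N. rewrite plus_INR. lra. }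
  (* Since N/(N - k) = 1 + k/(N - k), [E] is the difference between the rescaled sequence and
     [u]. *)
  set (E := fun k => (RtoC (INR k / (INR N - INR k)) * u k)%Cx).
  assert (HE : forall k, (k < n)%nat -> Cmod (E k) <= d).
  { intros k Hk. pose proof (HNk k Hk) as h. pose proof (pos_INR k). pose proof (lt_INR _ _ Hk).
    assert (Hf : 0 <= INR k / (INR N - INR k) <= INR n / INR K).
    { split.
      - apply Rmult_le_pos; [lra|]. left; apply Rinv_0_lt_compat; lra.
      - unfold Rdiv. apply Rmult_le_compat; try lra.
        + left; apply Rinv_0_lt_compat; lra.
        + apply Rinv_le_contravar; lra. }
    unfold E. rewrite Cmod_RtoC_mul by apply Hf.
    unfold d. replace (B * INR n / INR K) with (INR n / INR K * B) by (field; lra).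
    apply Rmult_le_compat; [apply Hf|apply Cmod_ge0|apply Hf|now apply HBk]. }
  intros v Hv.
  rewrite (quad_ext n _ (fun i j => Toep u i j + Toep E i j)%Cx v v); [| |reflexivity].
  2:{ intros i j Hi Hj. rewrite <- Toep_add. apply (Toep_ext _ _ n); [|lia|lia].
      intros k Hk. unfold E. pose proof (HNk k Hk).
      transitivity (RtoC (1 + INR k / (INR N - INR k)) * u k)%Cx.
      - f_equal. f_equal. field. lra.
      - rewrite RtoC_add. fold Cone. ring. }
  rewrite quad_add, Cre_add.
  pose proof (quad_ge_entries n (Toep E) d v) as HEq.
  assert (forall i j, (i < n)%nat -> (j < n)%nat -> Cmod (Toep E i j) <= d).
  { intros i j Hi Hj. unfold Toep. destruct (Nat.leb j i); [|rewrite Cmod_conj]; apply HE; lia. }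
  specialize (HEq H). pose proof (Hq v). pose proof (Rsum_norm2_gt0 n v Hv). nra.
Qed.

(** The sequence is first multiplied by N/(N - k), which the margin [eps] allows, then extended to
    size N without changing its first [n] terms. The moments of the Fejer weights carry the factor
    (N - k)/N, which restores [u]. *)
Lemma vandermonde_decomposition (n : nat) (u : nat -> Cx) (eps : R) :
  (1 <= n)%nat -> Cim (u O) = 0 -> 0 < eps ->
  (forall v, eps * Rsum n (fun i => Cnorm2 (v i)) <= Cre (quad n (Toep u) v)) ->
  exists (L : nat) (w f : nat -> R),
    (forall m, 0 <= w m) /\ (forall m, (m < L)%nat -> 0 <= f m <= 1) /\
    forall k, (k < n)%nat -> u k = Csum L (fun m => RtoC (w m) * wave (f m) k)%Cx.
Proof.
  intros Hn Hu He Hq. destruct (posdef_Toep_unwindow n u eps He Hq) as [N [HN HP]].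
  assert (HNp : 0 < INR N) by (apply lt_0_INR; lia).
  destruct (fun h => posdef_Toep_extend_to n N _ Hn (Nat.lt_le_incl _ _ HN) h HP) as [u' [Hag HP']].
  { cx_unfold. rewrite Hu. ring. }
  destruct (fejer_weights N u') as [w [Hw Hsum]]; [lia| |exact HP'|].
  { rewrite Hag by lia. cx_unfold. rewrite Hu. ring. }
  exists (2 * N)%nat, w, (fun m => INR m / INR (2 * N)). split; [exact Hw|]. split.
  - intros m Hm. assert (0 < INR (2 * N)) by (apply lt_0_INR; lia).
    apply lt_INR in Hm. pose proof (pos_INR m). split.
    + apply Rmult_le_pos; [lra|]. left; now apply Rinv_0_lt_compat.
    + apply (Rmult_le_reg_r (INR (2 * N))); [lra|]. unfold Rdiv.
      rewrite Rmult_assoc, Rinv_l by lra. lra.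
  - intros k Hk. rewrite Hsum, Hag by lia. apply lt_INR in Hk. apply lt_INR in HN.
    transitivity (RtoC ((INR N - INR k) / INR N * (INR N / (INR N - INR k))) * u k)%Cx.
    + replace ((INR N - INR k) / INR N * (INR N / (INR N - INR k))) with 1 by (field; lra).
      fold Cone. ring.
    + rewrite RtoC_mul. ring.
Qed.

(** * Atomic norms *)

(** [Rinf] has a default value, so it means something only once a greatest lower bound exists;
    completeness applied to the reflected set -E provides one. *)
Lemma Rinf_glb (E : R -> Prop) (b : R) :
  (exists r, E r) -> is_lower_bound E b -> is_glb E (Rinf E).
Proof.
  intros [r Hr] Hb.
  assert (H : exists m, is_glb E m).
  { destruct (completeness (fun y => E (- y))) as [m [Hm1 Hm2]].
    - exists (- b). intros y Hy. apply Hb in Hy. lra.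
    - exists (- r). now rewrite Ropp_involutive.
    - exists (- m). split.
      + intros y Hy. assert (- y <= m); [|lra]. apply Hm1. now rewrite Ropp_involutive.
      + intros c Hc. assert (m <= - c); [|lra]. apply Hm2. intros y Hy. apply Hc in Hy. lra. }
  unfold Rinf. destruct (excluded_middle_informative _) as [h|h]; [|contradiction].
  apply proj2_sig.
Qed.

Lemma glb_approx (E : R -> Prop) (m eps : R) :
  is_glb E m -> 0 < eps -> exists r, E r /\ r <= m + eps.
Proof.
  intros [H1 H2] He. apply NNPP; intros Hn.
  assert (m + eps <= m); [|lra]. apply H2. intros y Hy.
  destruct (Rle_lt_dec y (m + eps)) as [h|h]; [|lra]. elim Hn. now exists y.
Qed.

Lemma atom_wave (f phi : R) (t : nat) : atom f phi t = (wave f t * Cexpi phi)%Cx.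
Proof. unfold atom, wave. apply Cexpi_add. Qed.

(** Arbitrary complex coefficients are admissible: [atom_comb] sees only the modulus of a
    coefficient, and its argument goes into the phase of the atom. *)
Lemma atom_list_of_coefs (L : nat) (f : nat -> R) (d : nat -> Cx) :
  (forall m, (m < L)%nat -> 0 <= f m <= 1) ->
  exists l, valid_atoms l /\
    (forall t, atom_comb l t = Csum L (fun m => d m * wave (f m) t)%Cx) /\
    atom_cost l = Rsum L (fun m => Cmod (d m)).
Proof.
  induction L as [|L IH]; intros Hf.
  - exists nil. split; [constructor|]. now split.
  - destruct IH as [l [H1 [H2 H3]]]; [intros; apply Hf; lia|].
    destruct (polar (d L)) as [phi [Hphi Hd]].
    exists ((d L, f L, phi) :: l). split; [|split].
    + constructor; [|exact H1]. split; [apply Hf; lia|exact Hphi].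
    + intros t. simpl. rewrite H2, atom_wave. rewrite Hd at 2. ring.
    + simpl. rewrite H3. ring.
Qed.

Lemma atom_cost_ge0 (l : list (Cx * R * R)) : 0 <= atom_cost l.
Proof.
  induction l as [|[[c f] phi] l IH]; simpl; [lra|]. pose proof (Cmod_ge0 c). lra.
Qed.

(** Ties the two sides of the theorem together: each weighted atom is a rank one Toeplitz matrix.
    The phase cancels against its conjugate, and [c] is real so that conjugation above the diagonal
    leaves it fixed. *)
Lemma Toep_wave (c f phi : R) (i j : nat) :
  Toep (fun k => RtoC c * wave f k)%Cx i j
  = (RtoC c * (atom f phi i * Cconj (atom f phi j)))%Cx.
Proof.
  assert (Hphi : (Cexpi phi * Cconj (Cexpi phi))%Cx = Cone).
  { rewrite <- Cexpi_opp, <- Cexpi_add, Rplus_opp_r. apply Cexpi_0. }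
  transitivity (RtoC c * (wave f i * Cconj (wave f j)))%Cx.
  - unfold Toep. destruct (Nat.leb_spec j i) as [h|h].
    + replace (wave f i) with (wave f (j + (i - j))) by (f_equal; lia). rewrite wave_add.
      transitivity (RtoC c * (wave f (i - j) * (wave f j * Cconj (wave f j))))%Cx; [|ring].
      rewrite wave_conj_self. ring.
    + replace (wave f j) with (wave f (i + (j - i))) by (f_equal; lia).
      rewrite wave_add, !Cconj_mul, Cconj_RtoC.
      transitivity (RtoC c * (Cconj (wave f (j - i)) * (wave f i * Cconj (wave f i))))%Cx; [|ring].
      rewrite wave_conj_self. ring.
  - rewrite !atom_wave, Cconj_mul.
    transitivity (RtoC c * (wave f i * Cconj (wave f j) * (Cexpi phi * Cconj (Cexpi phi))))%Cx;
      [rewrite Hphi|]; ring.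
Qed.

Lemma Toep_Csum (L : nat) (u : nat -> nat -> Cx) (i j : nat) :
  Toep (fun k => Csum L (fun m => u m k)) i j = Csum L (fun m => Toep (u m) i j).
Proof. unfold Toep. destruct (Nat.leb j i); [reflexivity|apply Csum_conj]. Qed.

Lemma quad_rank1 (n : nat) (c : Cx) (a v : nat -> Cx) :
  let s := Csum n (fun j => Cconj (a j) * v j)%Cx in
  quad n (fun i j => c * (a i * Cconj (a j)))%Cx v = (c * (Cconj s * s))%Cx.
Proof.
  intros s. unfold quad.
  rewrite (Csum_ext n _ (fun i => (c * s) * (Cconj (Cconj (a i) * v i)))%Cx).
  - rewrite Csum_mul_l, <- Csum_conj. fold s. ring.
  - intros i Hi. unfold s. rewrite Cconj_mul, Cconj_conj, <- Csum_mul_l, <- Csum_mul_r.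
    apply Csum_ext; intros j Hj. ring.
Qed.

(* If T = sum_m w_m a_m a_m^* and z = T y, then z = sum_m d_m a_m with d_m = w_m <a_m, y>, and
   AM-GM bounds sum |d_m| by (sum w_m + sum w_m |<a_m, y>|^2) / 2. *)
Lemma atomic_norm_set_vandermonde (n L : nat) (u y z : nat -> Cx) (w f : nat -> R) :
  (1 <= n)%nat -> (forall m, 0 <= w m) -> (forall m, (m < L)%nat -> 0 <= f m <= 1) ->
  (forall k, (k < n)%nat -> u k = Csum L (fun m => RtoC (w m) * wave (f m) k)%Cx) ->
  (forall i, (i < n)%nat -> mulv n (Toep u) y i = z i) ->
  exists r, atomic_norm_set n z r /\ r <= (Cre (u O) + Cre (quad n (Toep u) y)) / 2.
Proof.
  intros Hn Hw Hf Hu Hz.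
  assert (HT : forall i j, (i < n)%nat -> (j < n)%nat -> Toep u i j
    = Csum L (fun m => RtoC (w m) * (wave (f m) i * Cconj (wave (f m) j)))%Cx).
  { intros i j Hi Hj. rewrite (Toep_ext u _ n i j Hu), Toep_Csum by lia.
    apply Csum_ext; intros m Hm. rewrite (Toep_wave _ _ 0), !atom_wave, Cexpi_0, !Cconj_mul, Cconj_Cone.
    ring. }
  set (s := fun m => Csum n (fun j => Cconj (wave (f m) j) * y j)%Cx).
  destruct (atom_list_of_coefs L f (fun m => RtoC (w m) * s m)%Cx Hf) as [l [H1 [H2 H3]]].
  exists (atom_cost l). split.
  - exists l. split; [exact H1|]. split; [|reflexivity].
    intros i Hi. rewrite H2, <- Hz by exact Hi. unfold mulv.
    rewrite (Csum_ext n _ (fun j => Csum L (fun m =>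
      RtoC (w m) * (wave (f m) i * Cconj (wave (f m) j)) * y j)%Cx)).
    2:{ intros j Hj. now rewrite HT, Csum_mul_r. }
    rewrite Csum_swap. apply Csum_ext; intros m Hm. unfold s.
    transitivity (RtoC (w m) * wave (f m) i * Csum n (fun j => Cconj (wave (f m) j) * y j))%Cx; [|ring].
    rewrite <- Csum_mul_l. apply Csum_ext; intros; ring.
  - assert (Hu0 : Cre (u O) = Rsum L w).
    { rewrite Hu by lia. rewrite Csum_Rsum_re. apply Rsum_ext; intros m _. rewrite wave_0.
      cx_unfold. ring. }
    assert (Hq : quad n (Toep u) y = RtoC (Rsum L (fun m => w m * Cnorm2 (s m)))).
    { rewrite (quad_ext n _ (fun i j => Csum L (fun m =>
         RtoC (w m) * (wave (f m) i * Cconj (wave (f m) j))))%Cx y y HT) by reflexivity.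
      rewrite <- Csum_RtoC.
      transitivity (Csum L (fun m => quad n (fun i j =>
         RtoC (w m) * (wave (f m) i * Cconj (wave (f m) j)))%Cx y)).
      - symmetry. unfold quad. rewrite Csum_swap. apply Csum_ext; intros i Hi.
        rewrite Csum_swap. apply Csum_ext; intros j Hj.
        now rewrite Csum_mul_l, Csum_mul_r.
      - apply Csum_ext; intros m Hm. rewrite quad_rank1. fold (s m).
        now rewrite Cconj_mul_self, RtoC_mul. }
    rewrite H3, Hu0, Hq. unfold Cre, RtoC at 2; simpl.
    rewrite <- Rsum_add. unfold Rdiv. rewrite Rmult_comm, <- Rsum_mul_l.
    apply Rsum_le; intros m _. rewrite Cmod_RtoC_mul, <- Cmod_sqr by apply Hw.
    (* AM-GM in the form w_m (|s_m| - 1)^2 >= 0. *)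
    pose proof (Hw m). pose proof (pow2_ge_0 (Cmod (s m) - 1)).
    pose proof (Rmult_le_pos _ _ H H0). nra.
Qed.

(** The sequence (e, 0, 0, ...) generates e I, so a multiple of the identity can be added without
    leaving the Toeplitz matrices. *)
Lemma quad_Toep_delta (n : nat) (e : R) (v : nat -> Cx) :
  quad n (Toep (fun k => if Nat.eqb k 0 then RtoC e else C0)) v
  = RtoC (e * Rsum n (fun i => Cnorm2 (v i))).
Proof.
  rewrite RtoC_mul, <- Csum_RtoC, <- Csum_mul_l. unfold quad.
  apply Csum_ext; intros i Hi. rewrite (Csum_single n i _ Hi).
  - unfold Toep. rewrite Nat.leb_refl, Nat.sub_diag. simpl Nat.eqb. cbv iota.
    rewrite <- Cconj_mul_self. ring.
  - intros j Hj Hne. unfold Toep.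
    destruct (Nat.leb_spec j i).
    + destruct (Nat.eqb_spec (i - j) 0); [lia|ring].
    + destruct (Nat.eqb_spec (j - i) 0); [lia|rewrite Cconj_C0; ring].
Qed.

Lemma coercive_posdef (n : nat) (M : nat -> nat -> Cx) (eps : R) :
  0 < eps -> (forall v, eps * Rsum n (fun i => Cnorm2 (v i)) <= Cre (quad n M v)) -> posdef n M.
Proof. intros He H v Hv. pose proof (H v). pose proof (Rsum_norm2_gt0 n v Hv). nra. Qed.

Lemma quad_re_solution (n : nat) (M : nat -> nat -> Cx) (y z : nat -> Cx) :
  (forall i, (i < n)%nat -> mulv n M y i = z i) ->
  quad n M y = Csum n (fun s => Cconj (y s) * z s)%Cx.
Proof.
  intros H. rewrite quad_form. apply Csum_ext; intros i Hi. now rewrite H.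
Qed.

(** The form at the first basis vector is this diagonal entry, and [psd] makes it real;
    [Toep_hermitian] needs this. *)
Lemma psd_diag0_real (n : nat) (M : nat -> nat -> Cx) :
  (1 <= n)%nat -> psd n M -> Cim (M O O) = 0.
Proof.
  intros Hn H. destruct (H (fun i => if Nat.ltb i 1 then Cone else C0)) as [H1 _].
  rewrite (quad_restrict n 1 M (fun _ => Cone) Hn) in H1.
  rewrite <- H1. unfold quad. cx_unfold. ring.
Qed.

(** Adding eps I makes the matrix coercive, so that (T + eps I) y = z is solvable and the
    Vandermonde decomposition applies. Here q is the form of T + eps I at [y]: dropping the term eps
    |y|^2 gives the first bound, used later in the block inequality, and AM-GM gives the second. *)
Lemma psd_Toep_atoms (n : nat) (u z : nat -> Cx) (eps : R) :
  (1 <= n)%nat -> psd n (Toep u) -> 0 < eps ->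
  exists y r, atomic_norm_set n z r /\
    let q := Cre (Csum n (fun s => Cconj (y s) * z s)%Cx) in
    Cre (quad n (Toep u) y) <= q /\ r <= (Cre (u O) + eps + q) / 2.
Proof.
  intros Hn Hp He.
  set (u' := fun k => (u k + (if Nat.eqb k 0 then RtoC eps else C0))%Cx).
  assert (Hq : forall v, Cre (quad n (Toep u') v)
     = Cre (quad n (Toep u) v) + eps * Rsum n (fun i => Cnorm2 (v i))).
  { intros v. rewrite (quad_ext n (Toep u') _ v v (fun i j _ _ => Toep_add _ _ i j)) by reflexivity.
    now rewrite quad_add, quad_Toep_delta, Cre_add. }
  assert (Hco : forall v, eps * Rsum n (fun i => Cnorm2 (v i)) <= Cre (quad n (Toep u') v)).
  { intros v. rewrite Hq. destruct (Hp v). lra. }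
  assert (Hu0 : Cim (u' O) = 0).
  { unfold u'. rewrite Cim_add. pose proof (psd_diag0_real n _ Hn Hp) as h. unfold Toep in h.
    simpl in h. simpl Nat.eqb. cbv iota. rewrite h. simpl. lra. }
  destruct (vandermonde_decomposition n u' eps Hn Hu0 He Hco) as [L [w [f [Hw [Hf Hu]]]]].
  destruct (posdef_solve n (Toep u') z (coercive_posdef n _ eps He Hco)) as [y Hy].
  destruct (atomic_norm_set_vandermonde n L u' y z w f Hn Hw Hf Hu Hy) as [r [Hr Hle]].
  exists y, r. split; [exact Hr|].
  intros q. rewrite (quad_re_solution n _ y z Hy) in Hle. fold q in Hle. split.
  - pose proof (Hq y) as h. rewrite (quad_re_solution n _ y z Hy) in h. fold q in h.
    assert (0 <= Rsum n (fun i => Cnorm2 (y i))) by (apply Rsum_ge0; intros; apply Cnorm2_ge0).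
    nra.
  - replace (Cre (u' O)) with (Cre (u O) + eps) in Hle; [exact Hle|].
    unfold u'. rewrite Cre_add. reflexivity.
Qed.

(** The point is that every vector has some atomic decomposition; it comes from the preceding lemma
    applied to the identity matrix. *)
Lemma atomic_norm_glb (n : nat) (z : nat -> Cx) :
  (1 <= n)%nat -> is_glb (atomic_norm_set n z) (atomic_norm n z).
Proof.
  intros Hn. apply Rinf_glb with 0.
  - destruct (psd_Toep_atoms n (fun k => if Nat.eqb k 0 then RtoC 1 else C0) z 1 Hn) as [_ [r [Hr _]]];
      [|lra|now exists r].
    intros v. rewrite quad_Toep_delta. simpl. split; [reflexivity|].
    assert (0 <= Rsum n (fun i => Cnorm2 (v i))) by (apply Rsum_ge0; intros; apply Cnorm2_ge0). lra.
  - intros r [l [_ [_ ->]]]. apply atom_cost_ge0.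
Qed.

Lemma atomic_norm_ge0 (n : nat) (z : nat -> Cx) : (1 <= n)%nat -> 0 <= atomic_norm n z.
Proof.
  intros Hn. apply (atomic_norm_glb n z Hn). intros r [l [_ [_ ->]]]. apply atom_cost_ge0.
Qed.

Lemma CA_norm_glb (n J : nat) (x : nat -> nat -> Cx) :
  (1 <= n)%nat -> is_glb (CA_set n J x) (CA_norm n J x).
Proof.
  intros Hn. apply Rinf_glb with 0.
  - eexists. exists (fun _ => C0), x. split; [intros; ring|reflexivity].
  - intros r [zc [z [_ ->]]]. apply Rplus_le_le_0_compat; [now apply atomic_norm_ge0|].
    apply Rsum_ge0; intros; now apply atomic_norm_ge0.
Qed.

(** * The linear matrix inequality *)

Definition block_vec (n J : nat) (Y : nat -> nat -> Cx) (g : Cx) (i : nat) : Cx :=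
  if Nat.ltb i ((J + 1) * n) then Y (i / n)%nat (i mod n)%nat else g.

Lemma block_div (n b s : nat) : (s < n)%nat -> ((b * n + s) / n = b)%nat.
Proof. intros H. rewrite Nat.div_add_l, Nat.div_small by lia. lia. Qed.
Lemma block_mod (n b s : nat) : (s < n)%nat -> ((b * n + s) mod n = s)%nat.
Proof. intros H. rewrite Nat.add_comm, Nat.Div0.mod_add. now apply Nat.mod_small. Qed.

Lemma mulv_lmi_block (n J : nat) (T Z : nat -> nat -> Cx) (t : R) (v : nat -> Cx) (b s : nat) :
  (b < J + 1)%nat -> (s < n)%nat ->
  mulv (S ((J + 1) * n)) (lmi_matrix n J T Z t) v (b * n + s)
  = (mulv n (Toep (T b)) (fun s => v (b * n + s)%nat) s + Z b s * v ((J + 1) * n)%nat)%Cx.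
Proof.
  intros Hb Hs. unfold mulv; simpl Csum.
  assert (HI : (b * n + s < (J + 1) * n)%nat) by nia.
  f_equal.
  - rewrite Csum_blocks, (Csum_single _ b _ Hb).
    + apply Csum_ext; intros s' Hs'. unfold lmi_matrix.
      destruct (Nat.ltb_spec (b * n + s) ((J + 1) * n)); [|lia].
      destruct (Nat.ltb_spec (b * n + s') ((J + 1) * n)); [|nia].
      now rewrite !block_div, !block_mod, Nat.eqb_refl by assumption.
    + intros b' Hb' Hne. apply Csum_0; intros s' Hs'. unfold lmi_matrix.
      destruct (Nat.ltb_spec (b * n + s) ((J + 1) * n)); [|lia].
      destruct (Nat.ltb_spec (b' * n + s') ((J + 1) * n)); [|nia].
      rewrite !block_div by assumption. destruct (Nat.eqb_spec b b'); [lia|]. ring.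
  - unfold lmi_matrix. destruct (Nat.ltb_spec (b * n + s) ((J + 1) * n)); [|lia].
    now rewrite Nat.ltb_irrefl, block_div, block_mod.
Qed.

Lemma mulv_lmi_last (n J : nat) (T Z : nat -> nat -> Cx) (t : R) (v : nat -> Cx) :
  mulv (S ((J + 1) * n)) (lmi_matrix n J T Z t) v ((J + 1) * n)
  = (Csum (J + 1) (fun b => Csum n (fun s => Cconj (Z b s) * v (b * n + s)%nat))
     + RtoC t * v ((J + 1) * n)%nat)%Cx.
Proof.
  unfold mulv; simpl Csum. f_equal.
  - rewrite Csum_blocks. apply Csum_ext; intros b Hb. apply Csum_ext; intros s Hs.
    unfold lmi_matrix. rewrite Nat.ltb_irrefl.
    destruct (Nat.ltb_spec (b * n + s) ((J + 1) * n)); [|nia].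
    now rewrite block_div, block_mod.
  - unfold lmi_matrix. now rewrite Nat.ltb_irrefl.
Qed.

(** Distinct blocks do not interact, so the form is a sum over blocks that are coupled only through
    the last coordinate [g]. *)
Lemma quad_lmi (n J : nat) (T Z : nat -> nat -> Cx) (t : R) (v : nat -> Cx) :
  let V b s := v (b * n + s)%nat in
  let g := v ((J + 1) * n)%nat in
  quad ((J + 1) * n + 1) (lmi_matrix n J T Z t) v
  = (Csum (J + 1) (fun b => quad n (Toep (T b)) (V b)
        + Csum n (fun s => Cconj (V b s) * Z b s) * g
        + Cconj g * Csum n (fun s => Cconj (Z b s) * V b s))
     + RtoC t * (Cconj g * g))%Cx.
Proof.
  intros V g. rewrite Nat.add_1_r, quad_form. unfold form. simpl Csum.
  rewrite mulv_lmi_last, Csum_blocks, Csum_add, Csum_mul_l. fold g.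
  rewrite (Csum_ext (J + 1) _ (fun b => quad n (Toep (T b)) (V b)
        + Csum n (fun s => Cconj (V b s) * Z b s) * g)%Cx); [unfold V; ring|].
  intros b Hb. rewrite quad_form. unfold form.
  rewrite <- Csum_mul_r, <- Csum_add. apply Csum_ext; intros s Hs.
  rewrite mulv_lmi_block by assumption. fold g. unfold V. ring.
Qed.

Lemma quad_lmi_block_vec (n J : nat) (T Z Y : nat -> nat -> Cx) (t : R) (g : Cx) :
  quad ((J + 1) * n + 1) (lmi_matrix n J T Z t) (block_vec n J Y g)
  = (Csum (J + 1) (fun b => quad n (Toep (T b)) (Y b)
        + Csum n (fun s => Cconj (Y b s) * Z b s) * g
        + Cconj g * Csum n (fun s => Cconj (Z b s) * Y b s))
     + RtoC t * (Cconj g * g))%Cx.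
Proof.
  rewrite quad_lmi.
  replace (block_vec n J Y g ((J + 1) * n)) with g.
  2:{ unfold block_vec. now rewrite Nat.ltb_irrefl. }
  assert (HY : forall b s, (b < J + 1)%nat -> (s < n)%nat ->
    block_vec n J Y g (b * n + s) = Y b s).
  { intros b s Hb Hs. unfold block_vec. destruct (Nat.ltb_spec (b * n + s) ((J + 1) * n)); [|nia].
    now rewrite block_div, block_mod. }
  f_equal. apply Csum_ext; intros b Hb. f_equal; [f_equal|].
  - apply quad_ext; [reflexivity|]. intros; now apply HY.
  - f_equal. apply Csum_ext; intros s Hs. now rewrite HY.
  - f_equal. apply Csum_ext; intros s Hs. now rewrite HY.
Qed.

(** The test vector is supported on block [b] and has last coordinate 0. *)
Lemma psd_lmi_block (n J : nat) (T Z : nat -> nat -> Cx) (t : R) (b : nat) :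
  (b < J + 1)%nat -> psd ((J + 1) * n + 1) (lmi_matrix n J T Z t) -> psd n (Toep (T b)).
Proof.
  intros Hb H v.
  specialize (H (block_vec n J (fun b' => if Nat.eqb b' b then v else fun _ => C0) C0)).
  rewrite quad_lmi_block_vec, Cconj_C0, (Csum_single _ b _ Hb), Nat.eqb_refl in H.
  - replace (quad n (Toep (T b)) v) with (quad n (Toep (T b)) v
        + Csum n (fun s => Cconj (v s) * Z b s) * C0
        + C0 * Csum n (fun s => Cconj (Z b s) * v s) + RtoC t * (C0 * C0))%Cx by ring.
    exact H.
  - intros i _ Hi. destruct (Nat.eqb_spec i b); [lia|].
    replace (quad n (Toep (T i)) (fun _ => C0)) with C0; [ring|].
    symmetry. rewrite quad_form. unfold form. apply Csum_0; intros. rewrite Cconj_C0. ring.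
Qed.

Lemma Cinner_conj (n : nat) (v w : nat -> Cx) :
  Csum n (fun s => Cconj (w s) * v s)%Cx = Cconj (Csum n (fun s => Cconj (v s) * w s)%Cx).
Proof.
  rewrite Csum_conj. apply Csum_ext; intros. rewrite Cconj_mul, Cconj_conj. ring.
Qed.

(* The test vector (y_0,...,y_J,-1) with (Toep (T b) + eps I) y_b = Z b bounds sum_b <y_b, Z b> by t. *)
Lemma lmi_atomic_norm_le (n J : nat) (T Z : nat -> nat -> Cx) (t eps : R) :
  (1 <= n)%nat -> 0 < eps -> psd ((J + 1) * n + 1) (lmi_matrix n J T Z t) ->
  Rsum (J + 1) (fun b => atomic_norm n (Z b))
  <= / 2 * Rsum (J + 1) (fun b => Cre (T b O)) + / 2 * t + INR (J + 1) * eps.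
Proof.
  intros Hn He Hp.
  (* The range condition sits under the existential so that choice yields a total function [Y]. The
     term eps/2 is relaxed to eps. *)
  assert (Hy : forall b, exists y, (b < J + 1)%nat ->
    let q := Cre (Csum n (fun s => Cconj (y s) * Z b s)%Cx) in
    Cre (quad n (Toep (T b)) y) <= q /\
    atomic_norm n (Z b) <= / 2 * Cre (T b O) + eps + / 2 * q).
  { intros b. destruct (Nat.lt_ge_cases b (J + 1)) as [Hb|Hb]; [|exists (fun _ => C0); lia].
    destruct (psd_Toep_atoms n (T b) (Z b) eps Hn (psd_lmi_block _ _ _ _ _ _ Hb Hp) He)
      as [y [r [Hr [H1 H2]]]].
    exists y. intros _ q. split; [exact H1|].
    apply (atomic_norm_glb n (Z b) Hn) in Hr. fold q in H2. lra. }
  set (Y := fun b => proj1_sig (constructive_indefinite_description _ (Hy b))).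
  set (q := fun b => Cre (Csum n (fun s => Cconj (Y b s) * Z b s)%Cx)).
  assert (HY : forall b, (b < J + 1)%nat -> Cre (quad n (Toep (T b)) (Y b)) <= q b /\
    atomic_norm n (Z b) <= / 2 * Cre (T b O) + eps + / 2 * q b)
    by exact (fun b => proj2_sig (constructive_indefinite_description _ (Hy b))).
  (* With last coordinate -1, block [b] contributes the form of [Y b] minus 2 [q b], hence at most
     -[q b], while the corner contributes [t]; the total is nonnegative. *)
  assert (Ht : Rsum (J + 1) q <= t).
  { destruct (Hp (block_vec n J Y (- Cone)%Cx)) as [_ H].
    rewrite quad_lmi_block_vec, Cre_add, Csum_Rsum_re in H.
    apply Rle_trans with (r1 := 0) (r3 := Rsum (J + 1) (fun b => - 1 * q b) + t) in H.
    - rewrite Rsum_mul_l in H. lra.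
    - apply Rplus_le_compat; [|right; cx_unfold; ring].
      apply Rsum_le; intros b Hb. destruct (HY b Hb) as [H1 _].
      rewrite (Cinner_conj n (Y b) (Z b)). unfold q in *. rewrite !Cre_add.
      set (c := Csum n (fun s => Cconj (Y b s) * Z b s)%Cx) in *.
      assert (Cre (c * (- Cone))%Cx = - Cre c) by (cx_unfold; ring).
      assert (Cre (Cconj (- Cone) * Cconj c)%Cx = - Cre c) by (cx_unfold; ring).
      lra. }
  apply Rle_trans with (Rsum (J + 1) (fun b => / 2 * Cre (T b O) + eps + / 2 * q b)).
  - apply Rsum_le; intros b Hb. apply (HY b Hb).
  - rewrite !Rsum_add, !Rsum_mul_l, Rsum_const. lra.
Qed.

(** The moment sequence of the measure with mass |c| at each frequency, that is, [atom_comb] with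
    the phases removed. Its Toeplitz matrix is the sum of the matrices |c| a a^*, and its entry at 0
    is the cost. *)
Definition atom_cov (l : list (Cx * R * R)) (k : nat) : Cx :=
  fold_right (fun '(c, f, _) acc => Cadd (Cmul (RtoC (Cmod c)) (wave f k)) acc) C0 l.

Lemma atom_cov_0 (l : list (Cx * R * R)) : atom_cov l 0 = RtoC (atom_cost l).
Proof.
  induction l as [|[[c f] phi] l IH]; simpl; [reflexivity|].
  rewrite IH, wave_0, RtoC_add. ring.
Qed.

(* The block matrix of a list of atoms is the sum of the rank one matrices |c| (a;1)(a;1)^*. *)
Lemma atom_list_quad (n : nat) (l : list (Cx * R * R)) (v : nat -> Cx) (g : Cx) :
  exists r, 0 <= r /\
    (quad n (Toep (atom_cov l)) v
     + Csum n (fun s => Cconj (v s) * atom_comb l s) * g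
     + Cconj g * Csum n (fun s => Cconj (atom_comb l s) * v s)
     + RtoC (atom_cost l) * (Cconj g * g))%Cx = RtoC r.
Proof.
  induction l as [|[[c f] phi] l [r [Hr IH]]].
  - exists 0. split; [lra|]. simpl. rewrite Cconj_C0, !Csum_0 by (intros; ring).
    replace (quad n (Toep (atom_cov nil)) v) with C0; [cx_ring|].
    symmetry. unfold quad. apply Csum_0; intros i _. apply Csum_0; intros j _.
    replace (Toep (atom_cov nil) i j) with C0; [ring|].
    unfold Toep; simpl. destruct (Nat.leb j i); [reflexivity|now rewrite Cconj_C0].
  - set (s := Csum n (fun j => Cconj (atom f phi j) * v j)%Cx).
    exists (Cmod c * Cnorm2 (s + g)%Cx + r). split.
    { pose proof (Rmult_le_pos _ _ (Cmod_ge0 c) (Cnorm2_ge0 (s + g)%Cx)). lra. }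
    rewrite RtoC_add, <- IH, RtoC_mul, <- Cconj_mul_self.
    rewrite (quad_ext n (Toep (atom_cov ((c, f, phi) :: l))) (fun i j =>
       RtoC (Cmod c) * (atom f phi i * Cconj (atom f phi j)) + Toep (atom_cov l) i j)%Cx v v);
      [| |reflexivity].
    2:{ intros i j _ _. rewrite <- Toep_wave, <- Toep_add. reflexivity. }
    rewrite quad_add, quad_rank1. fold s. simpl atom_cost. rewrite RtoC_add.
    rewrite (Csum_ext n (fun s => Cconj (v s) * atom_comb ((c, f, phi) :: l) s)%Cx
      (fun s => RtoC (Cmod c) * (Cconj (v s) * atom f phi s) + Cconj (v s) * atom_comb l s)%Cx)
      by (intros; simpl; ring).
    rewrite (Csum_ext n (fun s => Cconj (atom_comb ((c, f, phi) :: l) s) * v s)%Cx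
      (fun s => RtoC (Cmod c) * (Cconj (atom f phi s) * v s) + Cconj (atom_comb l s) * v s)%Cx)
      by (intros; simpl; rewrite Cconj_add, Cconj_mul, Cconj_RtoC; ring).
    rewrite !Csum_add, !Csum_mul_l, (Cinner_conj n (atom f phi) v). fold s.
    rewrite Cconj_add. ring.
Qed.

(** The corner is the sum of the costs, so it can be shared out among the blocks; each block with
    its share is then a sum of squares by [atom_list_quad]. *)
Lemma psd_lmi_atoms (n J : nat) (Z : nat -> nat -> Cx) (l : nat -> list (Cx * R * R)) :
  (forall b s, (b < J + 1)%nat -> (s < n)%nat -> Z b s = atom_comb (l b) s) ->
  psd ((J + 1) * n + 1)
    (lmi_matrix n J (fun b => atom_cov (l b)) Z (Rsum (J + 1) (fun b => atom_cost (l b)))).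
Proof.
  intros HZ v. rewrite quad_lmi.
  set (g := v ((J + 1) * n)%nat).
  rewrite <- Csum_RtoC, <- Csum_mul_r, <- Csum_add.
  assert (H : forall b, exists r, (b < J + 1)%nat -> 0 <= r /\
    (quad n (Toep (atom_cov (l b))) (fun s => v (b * n + s)%nat)
     + Csum n (fun s => Cconj (v (b * n + s)%nat) * Z b s) * g
     + Cconj g * Csum n (fun s => Cconj (Z b s) * v (b * n + s)%nat)
     + RtoC (atom_cost (l b)) * (Cconj g * g))%Cx = RtoC r).
  { intros b. destruct (Nat.lt_ge_cases b (J + 1)) as [Hb|Hb]; [|exists 0; lia].
    destruct (atom_list_quad n (l b) (fun s => v (b * n + s)%nat) g) as [r [Hr E]].
    exists r. intros _. split; [exact Hr|]. rewrite <- E. f_equal; f_equal; [f_equal|]; f_equal;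
      apply Csum_ext; intros s Hs; now rewrite HZ. }
  set (r := fun b => proj1_sig (constructive_indefinite_description _ (H b))).
  assert (Hr : forall b, (b < J + 1)%nat -> 0 <= r b /\ _)
    by exact (fun b => proj2_sig (constructive_indefinite_description _ (H b))).
  rewrite (Csum_ext (J + 1) _ (fun b => RtoC (r b))) by (intros b Hb; apply (Hr b Hb)).
  rewrite Csum_RtoC. split; [reflexivity|]. apply Rsum_ge0. intros b Hb. apply (Hr b Hb).
Qed.

Lemma trace_Toep (n : nat) (u : nat -> Cx) : Cre (trace n (Toep u)) = INR n * Cre (u O).
Proof.
  unfold trace. rewrite (Csum_ext n _ (fun _ => u O)).
  - rewrite Csum_const. cx_unfold. ring.
  - intros i _. unfold Toep. now rewrite Nat.leb_refl, Nat.sub_diag.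
Qed.

Lemma le_of_le_eps (a b c : R) : 0 <= c -> (forall eps, 0 < eps -> a <= b + c * eps) -> a <= b.
Proof.
  intros Hc H. apply Rnot_lt_le; intros Hlt.
  (* The denominator c + 1 covers c = 0 and still gives c eps <= (a - b)/2. *)
  pose proof (H ((a - b) / (2 * (c + 1))) ltac:(apply Rdiv_lt_0_compat; lra)) as h.
  assert (c * ((a - b) / (2 * (c + 1))) <= (a - b) / 2); [|lra].
  replace ((a - b) / 2) with ((c + 1) * ((a - b) / (2 * (c + 1)))) by (field; lra).
  apply Rmult_le_compat_r; [|lra]. left; apply Rdiv_lt_0_compat; lra.
Qed.

(** A Toeplitz matrix has constant diagonal, so its trace is n times the entry at 0 and the factor
    1/n cancels. *)
Lemma SDP_objective (n J : nat) (T : nat -> nat -> Cx) (t : R) : (1 <= n)%nat ->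
  / (2 * INR n) * (Cre (trace n (Toep (T O))) + Rsum J (fun j => Cre (trace n (Toep (T (S j))))))
    + / 2 * t
  = / 2 * Rsum (J + 1) (fun b => Cre (T b O)) + / 2 * t.
Proof.
  intros Hn. assert (0 < INR n) by (apply lt_0_INR; lia).
  rewrite Nat.add_1_r, Rsum_recl, trace_Toep.
  rewrite (Rsum_ext J _ (fun j => INR n * Cre (T (S j) O))) by (intros; apply trace_Toep).
  rewrite Rsum_mul_l. field. lra.
Qed.

(** Being the greatest lower bound of the feasible values determines the infimum and does not rest
    on the default value of [Rinf]. *)
Theorem theorem1 (n J : nat) (hn : (1 <= n)%nat) (hJ : (1 <= J)%nat)
  (x : nat -> nat -> Cx) :
  is_glb (SDP_set n J x) (CA_norm n J x).
Proof.
  split.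
  - intros r [uc [u [t [zc [z [Hz [Hp ->]]]]]]].
    set (T := fun b => match b with O => uc | S b' => u b' end) in Hp.
    set (Z := fun b => match b with O => zc | S b' => z b' end) in Hp.
    apply le_of_le_eps with (INR (J + 1)); [apply pos_INR|]. intros eps He.
    pose proof (SDP_objective n J T t hn) as E. simpl in E. rewrite E.
    eapply Rle_trans; [|apply (lmi_atomic_norm_le n J T Z t eps hn He Hp)].
    rewrite Nat.add_1_r, Rsum_recl.
    apply (CA_norm_glb n J x hn). exists zc, z. split; [exact Hz|reflexivity].
  - intros b Hb. apply (CA_norm_glb n J x hn). intros r [zc [z [Hz ->]]].
    set (Z := fun b => match b with O => zc | S b' => z b' end).
    change (atomic_norm n zc + Rsum J (fun j => atomic_norm n (z j)))
      with (atomic_norm n (Z O) + Rsum J (fun j => atomic_norm n (Z (S j)))).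
    rewrite <- (Rsum_recl J (fun b => atomic_norm n (Z b))), <- Nat.add_1_r.
    apply le_of_le_eps with (INR (J + 1)); [apply pos_INR|]. intros eps He.
    assert (Hl : forall b, exists l, (forall s, (s < n)%nat -> Z b s = atom_comb l s) /\
      atom_cost l <= atomic_norm n (Z b) + eps).
    { intros b'. destruct (glb_approx _ _ eps (atomic_norm_glb n (Z b') hn) He)
        as [r [[l [_ [H1 ->]]] H2]]. now exists l. }
    set (l := fun b => proj1_sig (constructive_indefinite_description _ (Hl b))).
    assert (Hl' : forall b, (forall s, (s < n)%nat -> Z b s = atom_comb (l b) s) /\
      atom_cost (l b) <= atomic_norm n (Z b) + eps)
      by exact (fun b => proj2_sig (constructive_indefinite_description _ (Hl b))).
    apply Rle_trans with (Rsum (J + 1) (fun b => atom_cost (l b))).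
    + apply Hb.
      (* At this point the trace part and the part from [t] each equal half the total cost, so the
         objective is the total cost. *)
      exists (atom_cov (l O)), (fun j => atom_cov (l (S j))),
        (Rsum (J + 1) (fun b => atom_cost (l b))), zc, z.
      split; [exact Hz|]. split.
      * pose proof (psd_lmi_atoms n J Z l (fun b s _ Hs => proj1 (Hl' b) s Hs)) as HP.
        (* The blocks of the goal are given by a case distinction on the index; they agree with
           those of [HP] block by block, so the comparison is made on the expanded forms. *)
        intros v. rewrite quad_lmi. specialize (HP v). rewrite quad_lmi in HP.
        rewrite (Csum_ext (J + 1) _ (fun b =>
          quad n (Toep (atom_cov (l b))) (fun s => v (b * n + s)%nat)
          + Csum n (fun s => Cconj (v (b * n + s)%nat) * Z b s) * v ((J + 1) * n)%nat
          + Cconj (v ((J + 1) * n)%nat) * Csum n (fun s => Cconj (Z b s) * v (b * n + s)%nat))%Cx);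
          [exact HP|].
        intros [|b'] _; reflexivity.
      * rewrite (SDP_objective n J (fun b => atom_cov (l b)) _ hn).
        rewrite (Rsum_ext (J + 1) (fun b => Cre (atom_cov (l b) O)) (fun b => atom_cost (l b))).
        -- field.
        -- intros b' _. now rewrite atom_cov_0.
    + rewrite <- Rsum_const, <- Rsum_add. apply Rsum_le; intros b' _. apply Hl'.
Qed.
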